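(* Let $k$ be a positive integer. Every signed bipartite planar graph of negative-girth at least $6k-2$ admits a circular $\frac{4k}{2k-1}$-coloring.
   Context: Graphs are finite, may have multiple edges but no loops; a signed graph $(G,\sigma)$ has $\sigma:E(G)\to\{+,-\}$. A cycle is negative if the product of the signs of its edges is $-$; the negative-girth is the length of a shortest negative cycle. For $r\ge2$, $(G,\sigma)$ admits a circular $r$-coloring iff it admits a circular $r$-tension: a pair $(D,f)$ with $D$ an orientation of $G$ and $f:E(G)\to(-r,r)$ such that $|f(e)|\in[1,r-1]$ for each positive edge, $|f(e)|\in[0,\frac r2-1]\cup[\frac r2+1,r)$ for each negative edge, and for every cycle $C$ the sum of $f$ over forward arcs of $C$ minus the sum over backward arcs equals $0$. *)

(* Defs.v *)
From HB Require Import structures.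
From mathcomp Require Import all_boot all_order all_algebra all_fingroup.
From mathcomp Require Import reals.

Set Implicit Arguments.
Unset Strict Implicit.
Unset Printing Implicit Defensive.

Import Order.TTheory GRing.Theory Num.Theory.
Local Open Scope ring_scope.

(* Parallel edges are distinct elements of [edge] with the same [ends]; the
   cardinality condition excludes loops. *)
Record signed_graph := SignedGraph {
  vert : finType;
  edge : finType;
  ends : edge -> {set vert};
  card_ends : forall e, #|ends e| = 2%N;
  negative : pred edge
}.

Section SignedGraph.
Variable G : signed_graph.

Definition sign (e : edge G) : int := (-1) ^+ negative e.

Definition bipartite : Prop :=
  exists A : {set vert G}, forall e, #|ends e :&: A| = 1%N.

(* The closed walk v_0 e_0 v_1 e_1 ... e_(n-1) v_0 is encoded by the sequence
   of the pairs (v_i, e_i).  As there are no loops, n >= 2; distinctness of the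
   edges only matters for n = 2. *)
Definition walk_step : rel (vert G * edge G) :=
  [rel d d' | ends d.2 == [set d.1; d'.1]].

Definition is_cycle (c : seq (vert G * edge G)) : bool :=
  [&& c != [::], path.cycle walk_step c, uniq (unzip1 c) & uniq (unzip2 c)].

Definition negative_cycle (c : seq (vert G * edge G)) : bool :=
  is_cycle c && (\prod_(d <- c) sign d.2 == -1).

(* Holds for every n when there is no negative cycle (infinite negative
   girth). *)
Definition negative_girth_ge (n : nat) : Prop :=
  forall c, negative_cycle c -> (n <= size c)%N.

(* A dart is an edge together with one of its two ends. *)
Definition dart := {d : vert G * edge G | d.1 \in ends d.2}.
Definition dart_vert (x : dart) : vert G := (val x).1.
Definition dart_edge (x : dart) : edge G := (val x).2.

Definition dart_adj : rel dart :=
  [rel x y | (dart_vert x == dart_vert y) || (dart_edge x == dart_edge y)].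

(* [flip] exchanges the two darts of each edge. *)
Definition is_flip (flip : {perm dart}) : Prop :=
  forall x, flip x != x /\ dart_edge (flip x) = dart_edge x.

(* [rot] permutes cyclically the darts at each vertex. *)
Definition is_rotation (rot : {perm dart}) : Prop :=
  forall x y, (y \in porbit rot x) = (dart_vert y == dart_vert x).

(* Planarity is the existence of a combinatorial map of genus 0.  Faces are the
   orbits of [flip * rot], that is of x |-> rot (flip x).  Since the genus is
   additive over connected components, Euler's formula is stated for all of them
   at once, 2 being contributed by each component; everything is counted on
   darts, so that isolated vertices are ignored. *)
Definition planar : Prop :=
  exists flip rot : {perm dart},
    [/\ is_flip flip, is_rotation rot &
        (#|porbits rot| + #|porbits (flip * rot)%g| =
         #|porbits flip| + 2 * n_comp dart_adj predT)%N].

Section Tension.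
Variable R : realType.

(* [D e] is the pair (tail, head) of the arc obtained by orienting e. *)
Definition is_orientation (D : edge G -> vert G * vert G) : Prop :=
  forall e, ends e = [set (D e).1; (D e).2].

(* In a cycle, e_i is traversed starting at v_i, so it is a forward arc exactly
   when its tail is v_i. *)
Definition cycle_sum (D : edge G -> vert G * vert G) (f : edge G -> R)
    (c : seq (vert G * edge G)) : R :=
  \sum_(d <- c | (D d.2).1 == d.1) f d.2
  - \sum_(d <- c | (D d.2).1 != d.1) f d.2.

Definition circular_tension (r : R)
    (D : edge G -> vert G * vert G) (f : edge G -> R) : Prop :=
  [/\ is_orientation D,
      forall e, - r < f e < r,
      forall e, ~~ negative e -> 1 <= `|f e| <= r - 1,
      forall e, negative e ->
        (0 <= `|f e| <= r / 2 - 1) || (r / 2 + 1 <= `|f e| < r) &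
      forall c, is_cycle c -> cycle_sum D f c = 0].

Definition circular_colorable (r : R) : Prop :=
  exists D f, circular_tension r D f.

End Tension.
End SignedGraph.

(* Main.v *)
Require Import Defs.
From HB Require Import structures.
From mathcomp Require Import all_boot all_order all_algebra all_fingroup.
From mathcomp Require Import reals.
From mathcomp Require Import zify ring lra.

Set Implicit Arguments.
Unset Strict Implicit.
Unset Printing Implicit Defensive.

Import Order.TTheory GRing.Theory Num.Theory.
Local Open Scope ring_scope.

(* Put r = 4k/(2k-1).  Scaling by 2k-1, it is enough to find a potential
   vert G -> Z/4k whose difference along an edge e is +-1 if e is negative and
   2k +- 1 if e is positive.  In a plane graph such a potential is the same
   thing as an orientation of the dual graph in which the net outdegree of a
   face is 2k modulo 4k if the face has an odd number of negative edges, and 0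
   otherwise.  A set of faces with an odd number of negative edges on its
   boundary has at least 6k-2 boundary edges, because this boundary is an even
   subgraph of G, hence contains a negative cycle.

   The orientation is found in two steps.  While some face has target 0, either
   it has a single neighbour and is merged with it, or two of its edges are
   lifted without creating a small odd cut (a lemma of C.-Q. Zhang).  Once all
   targets are 2k, a minimal even set of faces with a small boundary is
   contracted and its inside is oriented afterwards by the theorem of Lovasz,
   Thomassen, Wu and Zhang on orientations with prescribed net outdegrees modulo
   2m extending a preorientation at one vertex z0; here m = 2k. *)

(** With m = 2k the girth bound is 3m - 2, exactly the degree 2m - 2 + [nrm] that the theorem with a
    preoriented vertex demands of a set whose target is m modulo 2m. A set with target 0 needs 2m -
    2, and nothing guarantees it, since cycles with an even number of negative edges may be short.
    Such sets are the obstacle. Removing single vertices with target 0 beforehand ensures that a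
    minimal bad set has two vertices or more, so that contracting it makes progress; its small
    boundary is then what allows its outside to act as z0. Bipartiteness enters through parity: all
    dual cuts are even. The vertex z0 never belongs to the graph: only the numbers of its arcs to
    and from each vertex are recorded, so that arcs at z0 can be added or dropped without touching
    the graph. As Z/4k need not be a field, the passage from vanishing face sums to a potential
    counts elements instead of dimensions. *)

Section Nrm.
Variable m : nat.
Hypothesis m_gt0 : (0 < m)%N.
Local Notation M := ((2 * m)%:Z).

(* Distance to the nearest multiple of 2m: the |tau| of Lovasz et al. *)
Definition nrm (z : int) : int :=
  if (z %% M)%Z <= m%:Z then (z %% M)%Z else M - (z %% M)%Z.

Lemma nrm_rep z : exists2 t, (M %| z - t)%Z & `|t| = nrm z.
Proof.
have h2 : (z %% M)%Z < M by rewrite ltz_pmod //; lia.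
have h1 : 0 <= (z %% M)%Z by rewrite modz_ge0 //; lia.
have h0 : (M %| z - (z %% M)%Z)%Z by rewrite -eqz_mod_dvd modz_mod.
rewrite /nrm; case: ifP => h3; first by exists (z %% M)%Z => //; lia.
exists ((z %% M)%Z - M); last by lia.
by rewrite opprB addrCA rpredD // dvdzz.
Qed.

Lemma nrm_ge0 z : 0 <= nrm z.
Proof. by have [t _ <-] := nrm_rep z. Qed.

Lemma nrm_max z : nrm z <= m%:Z.
Proof. rewrite /nrm; case: ifP => h //; lia. Qed.

Lemma nrmE z t : `|t| <= m%:Z -> (M %| z - t)%Z -> nrm z = `|t|.
Proof.
move=> ht; rewrite -eqz_mod_dvd => /eqP hz; rewrite /nrm hz.
case: (lerP 0 t) => t0.
  rewrite modz_small; last by apply/andP; split; lia.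
  by case: ifP => ?; lia.
have -> : (t %% M)%Z = t + M.
  by rewrite -[LHS](modzDr t M) modz_small //; apply/andP; split; lia.
by case: ifP => ?; lia.
Qed.

Lemma nrm_le z t : (M %| z - t)%Z -> nrm z <= `|t|.
Proof.
move=> h; have := nrm_max z; case: (lerP `|t| m%:Z) => ht; last by lia.
by rewrite (nrmE ht h) lexx.
Qed.

Lemma eq_nrm x y : (M %| x - y)%Z -> nrm x = nrm y.
Proof. by rewrite -eqz_mod_dvd /nrm => /eqP ->. Qed.

Lemma nrmN x : nrm (- x) = nrm x.
Proof.
have [t ht e] := nrm_rep x; rewrite -e -[RHS]normrN; apply: nrmE.
  by rewrite normrN e nrm_max.
by rewrite -opprD rpredN.
Qed.

Lemma nrmD x y : nrm (x + y) <= nrm x + nrm y.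
Proof.
have [t ht et] := nrm_rep x; have [u hu eu] := nrm_rep y.
rewrite -et -eu; apply: le_trans (ler_normD _ _).
by apply: nrm_le; rewrite opprD addrACA rpredD.
Qed.

Lemma nrm_le_abs x : nrm x <= `|x|.
Proof. by apply: nrm_le; rewrite subrr. Qed.

Lemma dvdz2M z : (M %| z)%Z -> (2 %| z)%Z.
Proof. by apply: dvdz_trans; rewrite PoszM dvdz_mulr. Qed.

Lemma nrm_parity x : (2 %| nrm x - x)%Z.
Proof.
have [t /dvdz2M ht <-] := nrm_rep x.
have h : (2 %| `|t| - t)%Z.
  by case: (ger0P t) => t0; [rewrite subrr dvdz0 | apply/dvdzP; exists (- t);
    lia].
by have := rpredB h ht; rewrite opprB addrA subrK.
Qed.

End Nrm.

(** * Orientations of multigraphs modulo 2m *)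

(* A multigraph is given by the two end maps of its edges.  Loops stand for
   deleted edges: every reduction below keeps the types V and I and only changes
   the ends and the set S of live vertices. *)
Section Multigraph.
Variables (V I : finType).
Implicit Types (s t : I -> V) (A B S : {set V}) (o : I -> bool) (q : V -> int).

Definition sg (d : bool) : int := if d then 1 else -1.

(** Convention: an arc with [o e] true leaves [s e]. The two indicators cancel on a loop, which lets
    loops stand for deleted edges. *)
Definition net s t o x : int :=
  \sum_e sg (o e) * ((s e == x)%:Z - (t e == x)%:Z).

Definition cut s t A : int := \sum_e ((s e \in A) != (t e \in A))%:Z.

Lemma sum_indic A y : \sum_(x in A) (y == x)%:Z = (y \in A)%:Z :> int.
Proof.
case: (boolP (y \in A)) => yA.
  rewrite (bigD1 y) //= eqxx big1 ?addr0 // => x /andP [_ /negPf].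
  by rewrite eq_sym => ->.
by rewrite big1 // => x xA; case: eqP => // yx; rewrite yx xA in yA.
Qed.

Lemma sum_net s t o A :
  \sum_(x in A) net s t o x = \sum_e sg (o e) * ((s e \in A)%:Z - (t e \in A)%:Z).
Proof.
rewrite exchange_big; apply: eq_bigr => e _.
by rewrite -mulr_sumr sumrB !sum_indic.
Qed.

Lemma sum_dvd (J : finType) (P : pred J) (d : int) (f g : J -> int) :
  (forall j, P j -> (d %| f j - g j)%Z) ->
  (d %| \sum_(j | P j) f j - \sum_(j | P j) g j)%Z.
Proof. by move=> h; rewrite -sumrB; apply: rpred_sum. Qed.

Lemma cut_ge0 s t A : 0 <= cut s t A.
Proof. by apply: sumr_ge0. Qed.

Lemma cutC s t S A : (forall e, (s e \in S) && (t e \in S)) ->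
  A \subset S -> cut s t (S :\: A) = cut s t A.
Proof.
move=> hS AS; apply: eq_bigr => e _; have /andP [h1 h2] := hS e.
by rewrite !inE h1 h2 !andbT; do 2!case: (_ \in A).
Qed.

Lemma sumC q S A : A \subset S ->
  \sum_(x in S :\: A) q x = \sum_(x in S) q x - \sum_(x in A) q x.
Proof.
by move=> AS; rewrite [X in _ = X - _](big_setID A) /= (setIidPr AS) addrAC
  subrr add0r.
Qed.

Section Modulus.
Variable m : nat.
Local Notation M := ((2 * m)%:Z).

Definition solvable s t S q :=
  exists o, forall x, x \in S -> (M %| net s t o x - q x)%Z.

(** Both divisibilities are necessary: net outdegrees add up to 0 over S, and over A to the cut
    modulo 2, while the modulus is even. *)
Definition well_posed s t S q := [/\ forall e, (s e \in S) && (t e \in S),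
  (M %| \sum_(x in S) q x)%Z &
  forall A, A \subset S -> (2 %| \sum_(x in A) q x - cut s t A)%Z].

Definition fiber_sum S (pi : V -> V) q x := \sum_(u in S | pi u == x) q u.
Definition fiber_set S (pi : V -> V) B := [set u in S | pi u \in B].

Lemma sum_fiber_sum S pi q B :
  \sum_(x in B) fiber_sum S pi q x = \sum_(u in fiber_set S pi B) q u.
Proof.
rewrite [RHS](partition_big pi (mem B)) /=; last by move=> u; rewrite inE =>
  /andP [].
apply: eq_bigr => x xB; apply: eq_bigl => u; rewrite inE.
by case: eqP => [->|]; rewrite ?xB ?andbT ?andbF.
Qed.

Lemma cut_contract s t S pi B : (forall e, (s e \in S) && (t e \in S)) ->
  cut (pi \o s) (pi \o t) B = cut s t (fiber_set S pi B).
Proof.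
move=> hS; apply: eq_bigr => e _; have /andP [h1 h2] := hS e.
by rewrite !inE h1 h2.
Qed.

Lemma contract_well_posed s t S pi q : well_posed s t S q ->
  well_posed (pi \o s) (pi \o t) (pi @: S) (fiber_sum S pi q).
Proof.
case=> hS hq hp; split.
- by move=> e; have /andP [h1 h2] := hS e; rewrite /= !imset_f.
- rewrite sum_fiber_sum (_ : fiber_set _ _ _ = S) //.
  by apply/setP => u; rewrite inE; case: (boolP (u \in S)) => // h; rewrite
    imset_f.
- move=> B _; rewrite sum_fiber_sum (cut_contract _ _ hS); apply: hp.
  by apply/subsetP => u; rewrite inE => /andP [].
Qed.

Definition contract A a0 u : V := if u \in A then a0 else u.

(** The fibres of the contraction are A and the single vertices outside A. *)
Lemma contract_solution s t S q A a0 : (forall e, (s e \in S) && (t e \in S)) ->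
  A \subset S -> a0 \in A ->
  solvable (contract A a0 \o s) (contract A a0 \o t) (contract A a0 @: S)
    (fiber_sum S (contract A a0) q) ->
  exists2 o, (forall x, x \in S :\: A -> (M %| net s t o x - q x)%Z) &
    (M %| \sum_(x in A) net s t o x - \sum_(x in A) q x)%Z.
Proof.
move=> hS AS a0A [o ho].
have key x : x \in contract A a0 @: S ->
    (M %| \sum_(u in fiber_set S (contract A a0) [set x]) net s t o u
        - \sum_(u in fiber_set S (contract A a0) [set x]) q u)%Z.
  move=> /ho; rewrite -(@sum_fiber_sum _ _ q) big_set1; congr (_ %| _ - _)%Z.
  rewrite sum_net; apply: eq_bigr => e _; have /andP [h1 h2] := hS e.
  by rewrite !inE h1 h2.
exists o => [x|].
  rewrite inE => /andP [xA xS].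
  have <- : contract A a0 x = x by rewrite /contract (negPf xA).
  have := key _ (imset_f (contract A a0) xS).
  have -> : fiber_set S (contract A a0) [set contract A a0 x] = [set x].
    apply/setP => u; rewrite !inE /contract (negPf xA).
    case: ifP => uA; last by case: eqP => [->|]; rewrite ?xS ?andbF.
    rewrite (subsetP AS _ uA) /=; apply/eqP/eqP => e.
      by rewrite -e a0A in xA.
    by rewrite -e uA in xA.
  by rewrite !big_set1 /contract (negPf xA).
have := key _ (imset_f (contract A a0) (subsetP AS _ a0A)).
have -> : fiber_set S (contract A a0) [set contract A a0 a0] = A.
  apply/setP => u; rewrite !inE /contract a0A; case: ifP => uA.
    by rewrite eqxx andbT (subsetP AS).
  by case: eqP => [e|_]; [rewrite e a0A in uA | rewrite andbF].
by [].
Qed.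

Definition inside s t A e := (s e \in A) && (t e \in A).
(* The edges that are not inside A become loops at a0. *)
Definition inner_end s t A a0 (f : I -> V) e := if inside s t A e then f e else
  a0.
Definition cross s t A o x : int :=
  \sum_(e | ~~ inside s t A e) sg (o e) * ((s e == x)%:Z - (t e == x)%:Z).
(** For x in A these arcs join x to the outside of A; their numbers are the arcs at z0 once the
    outside is shrunk to z0. *)
Definition crossin s t A o x : int :=
  \sum_(e | ~~ inside s t A e) ((if o e then t e else s e) == x)%:Z.
Definition crossout s t A o x : int :=
  \sum_(e | ~~ inside s t A e) ((if o e then s e else t e) == x)%:Z.

Lemma crossE s t A o x : cross s t A o x = crossout s t A o x - crossin s t A o x.
Proof.
rewrite /crossout /crossin -sumrB; apply: eq_bigr => e _.
by case: (o e); rewrite /sg ?mul1r ?mulN1r ?opprB.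
Qed.

Lemma net_inner_end s t A a0 o x :
  net (inner_end s t A a0 s) (inner_end s t A a0 t) o x =
  \sum_(e | inside s t A e) sg (o e) * ((s e == x)%:Z - (t e == x)%:Z).
Proof.
rewrite /net [LHS](bigID (inside s t A)) /= [X in _ + X]big1 ?addr0 => [|e
  /negPf h].
  by apply: eq_bigr => e h; rewrite /inner_end h.
by rewrite /inner_end h subrr mulr0.
Qed.

(** An edge inside A contributes nothing at vertices outside A, so redirecting it keeps the targets
    already met there. *)
Lemma glue s t S q A a0 o1 : (forall e, (s e \in S) && (t e \in S)) ->
  A \subset S ->
  (forall x, x \in S :\: A -> (M %| net s t o1 x - q x)%Z) ->
  solvable (inner_end s t A a0 s) (inner_end s t A a0 t) A (fun x => q x -
    cross s t A o1 x) ->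
  solvable s t S q.
Proof.
move=> hS AS h1 [o2 h2].
exists (fun e => if inside s t A e then o2 e else o1 e) => x xS.
case: (boolP (x \in A)) => xA.
  have := h2 x xA; rewrite net_inner_end; congr (_ %| _)%Z.
  rewrite opprB addrA; congr (_ - _).
  rewrite /net [RHS](bigID (inside s t A)) /=; congr (_ + _).
    by apply: eq_bigr => e ->.
  by apply: eq_bigr => e /negPf ->.
have := h1 x; rewrite inE xA => /(_ xS); congr (_ %| _ - _)%Z.
apply: eq_bigr => e _; case: ifP => // /andP [h3 h4].
case: eqP => [e1|_]; first by rewrite -e1 h3 in xA.
case: eqP => [e1|_]; first by rewrite -e1 h4 in xA.
by rewrite subrr !mulr0.
Qed.

Lemma cut_inner_end s t A a0 B : 
  cut (inner_end s t A a0 s) (inner_end s t A a0 t) B =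
  \sum_(e | inside s t A e) ((s e \in B) != (t e \in B))%:Z.
Proof.
rewrite /cut [LHS](bigID (inside s t A)) /= [X in _ + X]big1 ?addr0 => [|e
  /negPf h].
  by apply: eq_bigr => e h; rewrite /inner_end h.
by rewrite /inner_end h eqxx.
Qed.

(** Boundary edges of B that lie inside A survive in the inner graph and the others become arcs at
    z0, so degrees are preserved. *)
Lemma cut_split s t A a0 B o : B \subset A ->
  cut s t B = cut (inner_end s t A a0 s) (inner_end s t A a0 t) B +
    (\sum_(x in B) crossin s t A o x + \sum_(x in B) crossout s t A o x).
Proof.
move=> BA; rewrite cut_inner_end /cut [LHS](bigID (inside s t A)) /=; congr (_
  + _).
rewrite -big_split /=.
under [RHS]eq_bigr do rewrite /crossin /crossout -big_split /=.
rewrite exchange_big; apply: eq_bigr => e /=; rewrite big_split /= !sum_indic.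
rewrite negb_and; have h x := contraNN (subsetP BA x).
case/orP => /h /negPf he; case: (o e); rewrite he.
all: by case: (_ \in B).
Qed.

Lemma inner_well_posed s t S q A a0 o : well_posed s t S q -> A \subset S -> a0
  \in A ->
  (M %| \sum_(x in A) net s t o x - \sum_(x in A) q x)%Z ->
  well_posed (inner_end s t A a0 s) (inner_end s t A a0 t) A (fun x => q x -
    cross s t A o x).
Proof.
case=> hS hq hp AS a0A ho; split.
- by move=> e; rewrite /inner_end; case: ifP => [|_]; rewrite ?a0A //.
- move: ho; rewrite sum_net (bigID (inside s t A)) /= big1 ?add0r; last first.
    by move=> e /andP [-> ->]; rewrite subrr mulr0.
  have <- : \sum_(x in A) cross s t A o x = \sum_(e | ~~ inside s t A e)
      sg (o e) * ((s e \in A)%:Z - (t e \in A)%:Z).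
    rewrite exchange_big /=; refine (eq_bigr _ _) => e _.
    by rewrite -mulr_sumr sumrB !sum_indic.
  by rewrite sumrB -rpredN opprB.
- move=> B BA; have := hp B (subset_trans BA AS).
  rewrite (cut_split s t a0 o BA) sumrB.
  under [X in _ -> (_ %| _ - X - _)%Z]eq_bigr do rewrite crossE.
  rewrite sumrB; set x := \sum_(x in B) q x; set y := cut _ _ _.
  set i := \sum_(x in B) crossin _ _ _ _ _; set j := \sum_(x in B) crossout _ _
    _ _ _.
  (* Passing to the inner graph lowers the target sum by j - i and the cut by i + j, so their
     difference changes by 2i. *)
  move=> h; have h2 : (2 %| i * 2)%Z by rewrite dvdz_mull.
  by have := rpredD h h2; congr (_ %| _)%Z; ring.
Qed.

End Modulus.
End Multigraph.

Lemma dvd2P (z : int) : reflect (exists k : int, z = k * 2) (2 %| z)%Z.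
Proof. exact: dvdzP. Qed.

(** Greedy choice: the first term counts positively if w > 0 and negatively otherwise; when w = 0,
    parity keeps the remainder within reach. *)
Lemma signed_sum (J : eqType) (r : seq J) (f : J -> int) (w : int) :
  uniq r -> (forall e, -1 <= f e <= 1) -> `|w| <= \sum_(e <- r) `|f e| ->
  (2 %| w - \sum_(e <- r) `|f e|)%Z ->
  exists o : J -> bool, \sum_(e <- r) sg (o e) * f e = w.
Proof.
move=> + hf; elim: r w => [|e r IH] w.
  by rewrite big_nil => _ hw _; exists xpredT; rewrite big_nil; lia.
rewrite big_cons; set F : int := \sum_(_ <- _) _ => /= /andP [er ur] hw /dvd2P
  [k hk].
have he : -1 <= f e <= 1 := hf e.
have {}hw : `|w| <= `|f e| + F := hw.
have {}hk : w - (`|f e| + F) = k * 2 := hk.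
have F0 : 0 <= F by apply: sumr_ge0.
have [//|||o ho] := IH (if 0 < w then w - `|f e| else w + `|f e|).
- by rewrite -/F; case: ifP => h0; lia.
- rewrite -/F; case: ifP => h0; apply/dvd2P; first by exists k; lia.
  by exists (k + `|f e|); lia.
exists (fun i => if i == e then (if 0 < w then 0 <= f e else f e < 0) else o i).
rewrite big_cons eqxx.
have -> : \sum_(j <- r) sg (if j == e then if 0 < w then 0 <= f e else f e < 0
  else o j)
    * f j = \sum_(j <- r) sg (o j) * f j.
  by apply: eq_big_seq => j jr; case: eqP => // je; rewrite -je jr in er.
by rewrite ho /sg; do 2!case: ifP; lia.
Qed.

(** * Reductions: merging, deleting and lifting *)

Section Multigraph.
Variables (V I : finType) (m : nat).
Implicit Types (s t : I -> V) (A B S : {set V}) (o : I -> bool) (q : V -> int).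
Local Notation M := ((2 * m)%:Z).


Lemma sum_pair q (x y : V) : x != y ->
  \sum_(u in [set x; y]) q u = q x + q y.
Proof. by move=> xy; rewrite big_setU1 ?big_set1 // !inE. Qed.

(** All edges at v go to y. Merging prescribes only the total of the pair; afterwards the parallel
    edges give v any net outdegree of the right parity up to its degree, and y is right because the
    total is. *)
Lemma merge_single s t S q v y w : well_posed m s t S q -> v \in S -> y \in S
  -> v != y ->
  (forall e, s e != t e -> (s e == v -> t e = y) /\ (t e == v -> s e = y)) ->
  `|w| <= cut s t [set v] -> (M %| q v - w)%Z -> (2 %| w - cut s t [set v])%Z ->
  solvable m (contract [set v; y] y \o s) (contract [set v; y] y \o t)
    (contract [set v; y] y @: S) (fiber_sum S (contract [set v; y] y) q) ->
  solvable m s t S q.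
Proof.
move=> hi vS yS vy hv hw1 hw2 hw3 hm; have [hS _ _] := hi; set A := [set v; y].
have AS : A \subset S by rewrite subUset !sub1set vS yS.
have yA : y \in A by rewrite !inE eqxx orbT.
have [o1 h1 h2] := contract_solution hS AS yA hm.
apply: (glue (a0 := y) hS AS h1).
have [hS2 hq2 hp2] := inner_well_posed hi AS yA h2.
set s2 := inner_end _ _ _ _ s in hS2 hq2 hp2 *; set t2 := inner_end _ _ _ _ t
  in hS2 hq2 hp2 *.
have hns e : ~~ inside s t A e -> s e != v /\ t e != v.
  rewrite /inside !inE; case: (eqVneq (s e) (t e)) => [->|/hv [e1 e2]].
    by rewrite andbb negb_or => /andP [].
  by split; apply: contra H => hh; [rewrite (e1 hh) hh|rewrite (e2 hh) hh];
     rewrite eqxx ?orbT.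
have cv : cross s t A o1 v = 0.
  by apply: big1 => e /hns [/negPf -> /negPf ->]; rewrite subrr mulr0.
have cutv : cut s t [set v] = \sum_e `|(s2 e == v)%:Z - (t2 e == v)%:Z|.
  apply: eq_bigr => e _; rewrite !inE /s2 /t2 /inner_end; case: ifP =>
    [_|/negbT/hns].
    by do 2!case: (_ == v).
  by case=> /negPf -> /negPf ->; rewrite subrr.
rewrite cutv in hw1 hw3.
have [|o2 ho2] := signed_sum (index_enum_uniq I) _ hw1 hw3.
  by move=> e; do 2!case: (_ == v).
exists o2.
have h3 : (M %| net s2 t2 o2 v - (q v - cross s t A o1 v))%Z.
  by rewrite cv subr0 [net _ _ _ _]ho2 -rpredN opprB.
have h4 : (M %| net s2 t2 o2 y - (q y - cross s t A o1 y))%Z.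
  have h5 : \sum_(x in A) net s2 t2 o2 x = 0.
    rewrite sum_net big1 // => e _; have /andP [-> ->] := hS2 e.
    by rewrite subrr mulr0.
  move: hq2 h5; rewrite !sum_pair // => hq2 h5.
  have := rpredD hq2 h3; rewrite -rpredN; congr (_ %| _)%Z.
  by rewrite -[net _ _ _ y](addrK (net s2 t2 o2 v)) [X in _ = X - _ - _]addrC
    h5; ring.
by move=> x; rewrite !inE => /orP [] /eqP ->.
Qed.

Definition nonloops s t := #|[set e | s e != t e]|.

Definition del_end s t (e : I) i := if i == e then s e else t i : V.

Lemma cut_del s t e A :
  cut s t A = cut s (del_end s t e) A + ((s e \in A) != (t e \in A))%:Z.
Proof.
rewrite /cut (bigD1 e) //= [in RHS](bigD1 e) //= /del_end eqxx eqxx add0r addrC.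
by congr (_ + _); apply: eq_bigr => i /negPf ->.
Qed.

Lemma nonloops_del s t e : s e != t e -> nonloops s t = (nonloops s (del_end s
  t e)).+1.
Proof.
move=> h; rewrite /nonloops (cardsD1 e) inE h /= add1n; congr (_.+1).
apply: eq_card => i; rewrite !inE /del_end.
by case: (eqVneq i e) => [->|]; rewrite ?eqxx.
Qed.

Definition delq s t q (e : I) d x := q x - sg d * ((s e == x)%:Z - (t e == x)%:Z).

Lemma sum_delq s t q e d A : \sum_(x in A) delq s t q e d x =
  \sum_(x in A) q x - sg d * ((s e \in A)%:Z - (t e \in A)%:Z).
Proof. by rewrite sumrB -mulr_sumr sumrB !sum_indic. Qed.

Lemma del_well_posed s t S q e d : well_posed m s t S q ->
  well_posed m s (del_end s t e) S (delq s t q e d).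
Proof.
case=> hS hq hp; split.
- move=> i; have /andP [h1 h2] := hS i; rewrite h1 /del_end.
  by case: eqP => // _; have /andP [] := hS e.
- by rewrite sum_delq; have /andP [-> ->] := hS e; rewrite subrr mulr0 subr0.
- move=> A /hp; rewrite sum_delq (cut_del s t e) => /dvd2P [k hk]; apply/dvd2P.
  move: hk; rewrite /sg; case: d; case: (s e \in A); case: (t e \in A) => /= hk;
   solve [exists k; lia | exists (k+1); lia].
Qed.

Lemma del_solvable s t S q e d : solvable m s (del_end s t e) S (delq s t q e
  d) ->
  solvable m s t S q.
Proof.
case=> o ho; exists (fun i => if i == e then d else o i) => x /ho.
rewrite /delq opprB addrA; congr (_ %| _ - _)%Z.
rewrite /net (bigD1 e) //= [in RHS](bigD1 e) //= /del_end eqxx subrr mulr0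
  add0r addrC.
by congr (_ + _); apply: eq_bigr => i /negPf ->.
Qed.

Definition oth s t (v : V) e := if s e == v then t e else s e.
(** Index [e1] receives the new edge between the two neighbours of v, and [e2] becomes a loop at v,
    that is, a deleted edge. *)
Definition lifts s t v (e1 e2 : I) i :=
  if i == e1 then oth s t v e1 else if i == e2 then v else s i.
Definition liftt s t v (e1 e2 : I) i :=
  if i == e1 then oth s t v e2 else if i == e2 then v else t i.

Definition at_vertex s t v (e : I) := (s e == v) (+) (t e == v).

Section Lift.
Variables (s t : I -> V) (v : V) (e1 e2 : I).
Hypotheses (he : e1 != e2) (h1 : at_vertex s t v e1) (h2 : at_vertex s t v e2).
Local Notation s' := (lifts s t v e1 e2).
Local Notation t' := (liftt s t v e1 e2).
Local Notation y := (oth s t v e1).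
Local Notation z := (oth s t v e2).

Lemma cut_lift A : cut s t A = cut s' t' A +
  (2 * (((y \in A) == (z \in A)) && ((y \in A) != (v \in A))))%:Z.
Proof.
rewrite /cut (bigD1 e1) // (bigD1 e2) 1?eq_sym //=.
rewrite [in RHS](bigD1 e1) // [in RHS](bigD1 e2) 1?eq_sym //=.
rewrite /lifts /liftt !eqxx [e2 == e1]eq_sym (negPf he).
set F : int := \sum_(_ | _) ((s _ \in A) != (t _ \in A))%:Z.
have -> : \sum_(i | (i != e1) && (i != e2)) ((s' i \in A) != (t' i \in A))%:Z = F.
  by apply: eq_bigr => i /andP [i1 i2]; rewrite /lifts /liftt (negPf i1) (negPf
    i2).
rewrite !addrA [X in _ = X]addrAC; congr (_ + _).
have hh e : at_vertex s t v e ->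
    (s e = v /\ oth s t v e = t e) \/ (t e = v /\ oth s t v e = s e).
  rewrite /at_vertex /oth; case: eqP => [->|_] /=; first by left.
  by move=> /eqP ->; right.
case: (hh _ h1) => [[-> <-]|[-> <-]]; case: (hh _ h2) => [[-> <-]|[-> <-]].
all: rewrite eqxx; move: (y \in A) (z \in A) (v \in A) => [] [] [] //=.
Qed.


Lemma nonloops_lift : (nonloops s' t' < nonloops s t)%N.
Proof.
have nl e : at_vertex s t v e -> s e != t e.
  by rewrite /at_vertex; apply: contraTneq => ->; rewrite addbb.
rewrite /nonloops; apply: proper_card; apply/properP; split.
  apply/subsetP => i; rewrite !inE /lifts /liftt.
  case: (i =P e1) => [-> _|_]; first exact: nl.
  by case: (i =P e2) => // ->; rewrite eqxx.
exists e2; first by rewrite inE nl.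
by rewrite inE /lifts /liftt [e2 == e1]eq_sym (negPf he) !eqxx.
Qed.

(** The new arc is subdivided at v: [e1] and [e2] form a directed path through v, which adds 0 to
    the net outdegree of v. *)
Lemma net_lift o' : exists o, forall x, net s t o x = net s' t' o' x.
Proof.
exists (fun e => if e == e1 then (o' e1 (+) (s e1 == v))
  else if e == e2 then ~~ (o' e1 (+) (s e2 == v)) else o' e) => x.
rewrite /net (bigD1 e1) // (bigD1 e2) 1?eq_sym //=.
rewrite [in RHS](bigD1 e1) // [in RHS](bigD1 e2) 1?eq_sym //=.
rewrite /lifts /liftt !eqxx [e2 == e1]eq_sym (negPf he) subrr mulr0 add0r addrA.
congr (_ + _); last first.
  by apply: eq_bigr => i /andP [i1 i2]; rewrite (negPf i1) (negPf i2).
have hh e : at_vertex s t v e ->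
    (s e = v /\ oth s t v e = t e /\ (s e == v)) \/
    (t e = v /\ oth s t v e = s e /\ (s e == v) = false).
  rewrite /at_vertex /oth; case: eqP => [->|_] /=; first by left.
  by move=> /eqP ->; right.
case: (hh _ h1) => [[a1 [a2 a3]]|[a1 [a2 a3]]];
case: (hh _ h2) => [[c1 [c2 c3]]|[c1 [c2 c3]]];
rewrite a3 c3 a1 c1 a2 c2 /sg; case: (o' e1) => /=; ring.
Qed.

Lemma lift_solvable S q : solvable m s' t' S q -> solvable m s t S q.
Proof. by case=> o' ho; have [o h] := net_lift o'; exists o => x /ho; rewrite
  h. Qed.

Lemma lift_well_posed S q : well_posed m s t S q -> well_posed m s' t' S q.
Proof.
case=> hS hq hp; split=> // [i|A /hp].
  have o_S e : oth s t v e \in S.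
    by rewrite /oth; case: ifP => _; have /andP [] := hS e.
  have vS : v \in S.
    move: h1; rewrite /at_vertex; have /andP [k1 k2] := hS e1.
    by case: eqP => [<-|_ /= /eqP <-].
  rewrite /lifts /liftt; case: (i =P e1) => _; first by rewrite !o_S.
  by case: (i =P e2) => _; rewrite ?vS ?hS.
rewrite (cut_lift A); case: andP => _ /=; rewrite ?addr0 // => /dvd2P [k hk].
by apply/dvd2P; exists (k + 1); lia.
Qed.

End Lift.

Definition psum q (a b : V -> int) A : int := \sum_(x in A) (q x - a x + b x).
Definition absum (a b : V -> int) A : int := \sum_(x in A) (a x + b x).

(* a x and b x are the numbers of predirected edges from z0 to x and from x to
   z0, so that q x - a x + b x is the target at x once they are counted.  X is
   the exceptional vertex with target 0 whose degree may be small; it is empty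
   if there is none. *)
Record cert s t S q (a b : V -> int) (X : {set V}) : Prop := Cert {
  cert_well_posed : well_posed m s t S q;
  cert_a : forall x, 0 <= a x;
  cert_b : forall x, 0 <= b x;
  cert_top : absum a b S
    <= (2 * m)%:Z - 2 + nrm m (psum q a b S);
  cert_X : (#|X| <= 1)%N;
  cert_X0 : forall x, x \in X -> (M %| q x - a x + b x)%Z;
  cert_cut : forall A, A \subset S -> A != set0 -> A != S -> A != X ->
    (2 * m)%:Z - 2 + nrm m (psum q a b A)
    <= cut s t A + absum a b A }.

(** The outside of A becomes z0. With the crossing arcs counted at z0, targets and degrees are
    unchanged, and the upper bound on the degree of A is the one required of z0. *)
Lemma inner_cert s t S q (a b : V -> int) (X : {set V}) A a0 o : well_posed m s
  t S q ->
  (forall x, 0 <= a x) -> (forall x, 0 <= b x) ->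
  A \subset S -> a0 \in A ->
  (M %| \sum_(x in A) net s t o x - \sum_(x in A) q x)%Z ->
  (#|X| <= 1)%N ->
  (forall x, x \in X -> (M %| q x - a x + b x)%Z) ->
  cut s t A + absum a b A <=
    (2 * m)%:Z - 2 + nrm m (psum q a b A) ->
  (forall B, B \subset A -> B != set0 -> B != A -> B != X ->
    (2 * m)%:Z - 2 + nrm m (psum q a b B)
    <= cut s t B + absum a b B) ->
  cert (inner_end s t A a0 s) (inner_end s t A a0 t) A (fun x => q x - cross s
    t A o x)
    (fun x => a x + crossin s t A o x) (fun x => b x + crossout s t A o x) X.
Proof.
move=> hi ha hb AS a0A ho X1 X0 hA hB.
have eq_p x : q x - cross s t A o x - (a x + crossin s t A o x) +
    (b x + crossout s t A o x) = q x - a x + b x by rewrite crossE; ring.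
have eq_d B : B \subset A ->
    cut (inner_end s t A a0 s) (inner_end s t A a0 t) B +
    \sum_(x in B) (a x + crossin s t A o x + (b x + crossout s t A o x)) =
    cut s t B + absum a b B.
  rewrite /absum; by move=> BA; rewrite (cut_split s t a0 o BA) !big_split /=;
    ring.
split.
- exact: inner_well_posed hi AS a0A ho.
- by move=> x; apply: addr_ge0 => //; apply: sumr_ge0.
- by move=> x; apply: addr_ge0 => //; apply: sumr_ge0.
- rewrite /psum /absum; under [X in nrm _ X]eq_bigr do rewrite eq_p.
  have c0 : cut (inner_end s t A a0 s) (inner_end s t A a0 t) A = 0.
    rewrite cut_inner_end big1 // => e /andP [-> ->] //.
  by have := eq_d A (subxx A); rewrite c0 add0r => ->.
- by [].
- by move=> x /X0; rewrite eq_p.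
- move=> B BA B0 BA' BX; rewrite /psum /absum; under [X in nrm _ X]eq_bigr do
    rewrite eq_p.
  by rewrite eq_d //; apply: hB.
Qed.

Lemma contract_cert s t S q (a b : V -> int) (X : {set V}) A a0 : cert s t S q
  a b X ->
  A \subset S -> a0 \in A -> (1 < #|A|)%N ->
  cert (contract A a0 \o s) (contract A a0 \o t) (contract A a0 @: S)
    (fiber_sum S (contract A a0) q)
    (fiber_sum S (contract A a0) a) (fiber_sum S (contract A a0) b) (X :\: A).
Proof.
case=> hi ha hb htop hX hX0 hcut AS a0A A2; have [hS _ _] := hi.
set pi := contract A a0.
have eq_p x : fiber_sum S pi q x - fiber_sum S pi a x + fiber_sum S pi b x =
    fiber_sum S pi (fun u => q u - a u + b u) x by rewrite /fiber_sum big_split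
      sumrB.
have eq_c x : fiber_sum S pi a x + fiber_sum S pi b x = fiber_sum S pi (fun u
  => a u + b u) x.
  by rewrite /fiber_sum big_split.
have preS : fiber_set S pi (pi @: S) = S.
  by apply/setP => u; rewrite inE; case: (boolP (u \in S)) => // h; rewrite
    imset_f.
have pre_pi B : B \subset pi @: S -> pi @: fiber_set S pi B = B.
  move=> BS; apply/setP => x; apply/imsetP/idP => [[u]|xB].
    by rewrite inE => /andP [_ h] ->.
  by have /imsetP [u uS e] := subsetP BS _ xB; exists u; rewrite // inE uS -e.
split.
- exact: contract_well_posed.
- by move=> x; apply: sumr_ge0.
- by move=> x; apply: sumr_ge0.
- rewrite /psum /absum; under eq_bigr do rewrite eq_c.
  under [X in nrm _ X]eq_bigr do rewrite eq_p.
  by rewrite !sum_fiber_sum preS.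
- exact: leq_trans (subset_leq_card (subsetDl _ _)) hX.
- move=> x; rewrite inE => /andP [xA xX]; rewrite eq_p /fiber_sum.
  have pix : pi x = x by rewrite /pi /contract (negPf xA).
  have hfib u : (pi u == x) = (u == x).
    rewrite /pi /contract; case: ifP => // uA.
    by apply/eqP/eqP => e; [rewrite -e a0A in xA | rewrite -e uA in xA].
  under eq_bigl do rewrite hfib.
  case: (boolP (x \in S)) => xS; last first.
    by rewrite big1 // => u /andP [uS /eqP ux]; rewrite ux (negPf xS) in uS.
  rewrite (big_pred1 x) ?hX0 // => u /=.
  by case: eqP => [->|]; rewrite ?xS ?andbF.
- move=> B BS B0 BS' BX.
  rewrite /psum /absum; under [X in nrm _ X]eq_bigr do rewrite eq_p.
  under [X in _ <= _ + X]eq_bigr do rewrite eq_c.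
  rewrite !sum_fiber_sum (cut_contract _ _ hS); apply: hcut.
  + by apply/subsetP => u; rewrite inE => /andP [].
  + by apply: contra B0 => /eqP h; rewrite -(pre_pi B BS) h imset0.
  + by apply: contra BS' => /eqP h; rewrite -{1}(pre_pi B BS) h.
  (* A preimage that meets A contains it, hence has at least two elements and is not X. *)
  + apply: contra BX => /eqP h; rewrite -h; apply/eqP.
    have [dis|] := boolP [disjoint (fiber_set S pi B) & A].
      rewrite -{1}(pre_pi B BS); have /setDidPl -> := dis.
      rewrite -[RHS]imset_id; apply: eq_in_imset => u uB.
      by rewrite /pi /contract (disjointFr dis uB).
    rewrite -setI_eq0 => /set0Pn [u]; rewrite 2!inE => /andP [/andP [uS uB] uA].
    have : A \subset fiber_set S pi B.
      apply/subsetP => w wA; rewrite inE (subsetP AS) //=.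
      by move: uB; rewrite /pi /contract wA uA.
    by move/subset_leq_card; rewrite h leqNgt (leq_ltn_trans hX A2).
Qed.

End Multigraph.

(** * The theorem of Lovasz, Thomassen, Wu and Zhang *)

(* [lia] would otherwise compare the sums behind these terms by conversion. *)
Ltac abstract_term x :=
  let y := fresh "y" in set y : int := x in *; clearbody y.
Ltac cut_lia :=
  repeat match goal with
  | |- context [@cut ?V ?I ?s ?t ?A] => abstract_term (@cut V I s t A)
  | |- context [@absum ?V ?a ?b ?A] => abstract_term (@absum V a b A)
  | |- context [nrm ?m ?z] => abstract_term (nrm m z)
  | _ : context [@cut ?V ?I ?s ?t ?A] |- _ => abstract_term (@cut V I s t A)
  | _ : context [@absum ?V ?a ?b ?A] |- _ => abstract_term (@absum V a b A)
  | _ : context [nrm ?m ?z] |- _ => abstract_term (nrm m z)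
  end; lia.

Section Cert.
Variables (V I : finType) (m : nat).
Implicit Types (s t : I -> V) (A B S X : {set V}) (q : V -> int).
Local Notation M := ((2 * m)%:Z).
Hypothesis m_gt1 : (1 < m)%N.

Let m_gt0 : (0 < m)%N. Proof. exact: ltnW. Qed.

Lemma card_contract S A a0 : A \subset S -> a0 \in A -> (1 < #|A|)%N ->
  (#|contract A a0 @: S| < #|S|)%N.
Proof.
move=> AS a0A A2; rewrite ltn_neqAle leq_imset_card andbT.
apply: contraTneq A2 => /eqP/imset_injP inj; rewrite -leqNgt -(cards1 a0).
apply: subset_leq_card; apply/subsetP => u uA; rewrite inE; apply/eqP.
by apply: inj; rewrite ?(subsetP AS) // /contract uA a0A.
Qed.

Lemma nonloops_contract s t (f : V -> V) : (nonloops (f \o s) (f \o t) <=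
  nonloops s t)%N.
Proof.
apply: subset_leq_card; apply/subsetP => e; rewrite !inE.
by apply: contraNneq => /= ->.
Qed.

Lemma nonloops_inner_end s t A a0 :
  (nonloops (inner_end s t A a0 s) (inner_end s t A a0 t) <= nonloops s t)%N.
Proof.
apply: subset_leq_card; apply/subsetP => e; rewrite !inE /inner_end.
by case: ifP; rewrite ?eqxx.
Qed.

Lemma psumD q (a b : V -> int) A : psum q a b A =
  \sum_(x in A) q x - \sum_(x in A) a x + \sum_(x in A) b x.
Proof. by rewrite /psum big_split sumrB. Qed.

Lemma absumD (a b : V -> int) A : absum a b A =
  \sum_(x in A) a x + \sum_(x in A) b x.
Proof. by rewrite /absum big_split. Qed.

Lemma psum1 q (a b : V -> int) x : psum q a b [set x] = q x - a x + b x.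
Proof. exact: big_set1. Qed.

(** Used as a gap: a degree below [M + nrm] is at most [M - 2 + nrm], the bound required of a new
    z0. *)
Lemma degree_parity s t S q (a b : V -> int) A : well_posed m s t S q -> A
  \subset S ->
  (2 %| cut s t A + absum a b A - nrm m (psum q a b A))%Z.
Proof.
case=> _ _ hp /hp /dvd2P [k hk]; apply/dvd2P.
have /dvd2P [l hl] := nrm_parity m_gt0 (psum q a b A).
move: hl; rewrite absumD psumD => hl.
by exists (\sum_(x in A) a x - k - l); lia.
Qed.

(** For a vertex z0 with [al] outgoing arcs and no incoming one: adding fewer than m incoming arcs
    keeps its degree bound. *)
Lemma nrm_switch (al j : int) : 0 <= al -> 1 <= j <= m%:Z - 1 ->
  al <= M - 2 + nrm m al -> al + j <= M - 2 + nrm m (j - al).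
Proof.
move=> al0 hj hal.
have hm := nrm_max m_gt0 al.
have al1 : al <= M - 1.
  rewrite leNgt; apply/negP => h.
  have := @nrm_le m m_gt0 al (al - M); rewrite opprB addrCA subrr addr0 dvdzz.
  by move=> /(_ isT); lia.
case: (lerP `|j - al| m%:Z) => h; first by rewrite (nrmE m_gt0 h) ?subrr //; lia.
rewrite (@nrmE m m_gt0 _ (j - al + M)); [lia|lia|].
by rewrite opprD addrA subrr add0r rpredN dvdzz.
Qed.

Lemma solve_small s t S q : (#|S| <= 1)%N -> well_posed m s t S q -> solvable m
  s t S q.
Proof.
move=> S1 [hS hq _]; exists xpredT => x xS.
have SE : S = [set x].
  by apply/esym/eqP; rewrite eqEcard sub1set xS cards1.
move: hq; rewrite SE big_set1 => hq; rewrite /net big1 ?sub0r ?rpredN // => e _.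
have := hS e; rewrite SE !inE => /andP [/eqP -> /eqP ->].
by rewrite subrr mulr0.
Qed.

Lemma single_neighbor s t S v : (forall e, (s e \in S) && (t e \in S)) ->
  (1 < #|S|)%N -> v \in S ->
  (forall e1 e2, at_vertex s t v e1 -> at_vertex s t v e2 ->
    oth s t v e1 = oth s t v e2) ->
  exists y, [/\ y \in S, v != y & forall e, s e != t e ->
    (s e == v -> t e = y) /\ (t e == v -> s e = y)].
Proof.
move=> hS S_gt1 vS oth_eq.
have oth_S e : oth s t v e \in S.
  by rewrite /oth; case: ifP => _; have /andP [] := hS e.
have [y [yS vy hy]] : exists y, [/\ y \in S, v != y &
    forall e, at_vertex s t v e -> oth s t v e = y].
  case: (pickP (at_vertex s t v)) => [e he|no].
    exists (oth s t v e); split=> // [|e' he']; last exact: oth_eq.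
    move: he; rewrite /at_vertex /oth.
    by case: (eqVneq (s e) v) => [_|h _] /=; rewrite 1?eq_sym.
  have : S :\ v != set0 by rewrite -card_gt0; move: S_gt1; rewrite (cardsD1 v) vS.
  case/set0Pn => y; rewrite !inE => /andP [yv yS]; exists y.
  by split=> // [|e]; rewrite ?no // eq_sym.
exists y; split=> // e nl; split=> /eqP h.
  have sv : t e != v by rewrite -h eq_sym.
  by rewrite -(hy e) /at_vertex /oth h eqxx // (negPf sv).
have sv : s e != v by rewrite -h.
by rewrite -(hy e) /at_vertex /oth (negPf sv) // h eqxx.
Qed.

(** * Inductive steps: tight sets, zero targets, deletion of an edge *)

Section Step.
Variables (s t : I -> V) (S : {set V}) (q a b : V -> int) (X : {set V}).
Hypothesis hc : cert m s t S q a b X.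
Hypothesis S_gt1 : (1 < #|S|)%N.
Hypothesis IH : forall s' t' S' q' a' b' X',
  (#|S'| + nonloops s' t' < #|S| + nonloops s t)%N ->
  cert m s' t' S' q' a' b' X' -> solvable m s' t' S' q'.

Local Notation p := (psum q a b).
Local Notation d A := (cut s t A + absum a b A).

(* A tight set is contracted first; then its complement becomes the new z0. *)
Lemma tight_step A : A \subset S -> (1 < #|A|)%N -> A != S ->
  d A < M + nrm m (p A) -> solvable m s t S q.
Proof.
move=> AS A2 AnS tight; have [hi ha hb htop hX hX0 hcut] := hc.
have [hS _ _] := hi.
have An0 : A != set0 by apply: contraTneq A2 => ->; rewrite cards0.
have AX : A != X by apply: contraTneq A2 => ->; rewrite -leqNgt.
have [a0 a0A] := set0Pn _ An0.
have := hcut A AS An0 AnS AX; have /dvd2P [k hk] := degree_parity a b hi AS =>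
  low.
have [o1 h1 h2] : exists2 o, (forall x, x \in S :\: A -> (M %| net s t o x - q
  x)%Z) &
    (M %| \sum_(x in A) net s t o x - \sum_(x in A) q x)%Z.
  apply: (contract_solution hS AS a0A); apply: (IH _ (contract_cert hc AS a0A
    A2)).
  by rewrite -addSn leq_add ?nonloops_contract ?card_contract.
apply: (glue (a0 := a0) hS AS h1).
apply: (IH _ (inner_cert hi ha hb AS a0A h2 hX hX0 _ _)).
- have Apr : A \proper S by rewrite properEneq AnS.
  by rewrite -addSn leq_add ?nonloops_inner_end // proper_card.
- by cut_lia.
- move=> B BA B0 BnA BX; apply: hcut => //; first exact: subset_trans AS.
  by apply: contra BnA => /eqP SB; rewrite eqEsubset BA SB AS.
Qed.

Hypothesis slack : forall A, A \subset S -> (1 < #|A|)%N -> A != S ->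
  M + nrm m (p A) <= d A.

(* A vertex with target 0 becomes exceptional, after which its edges can be
   lifted one pair at a time. *)
Lemma zero_step v : v \in S -> X = [set v] -> solvable m s t S q.
Proof.
move=> vS XE; have [hi ha hb htop hX hX0 hcut] := hc; have [hS hq hp] := hi.
case: (pickP (fun e : I * I => [&& at_vertex s t v e.1, at_vertex s t v e.2 &
    oth s t v e.1 != oth s t v e.2])) => [[e1 e2] /= /and3P [h1 h2 hy]|none].
  have he : e1 != e2 by apply: contraNneq hy => ->.
  apply: (lift_solvable he h1 h2).
  apply: (IH (a' := a) (b' := b) (X' := X)).
    by rewrite ltn_add2l nonloops_lift.
  split=> //; first exact: lift_well_posed.
  move=> A AS A0 AnS AX.
  have := hcut A AS A0 AnS AX; rewrite (cut_lift he h1 h2 A).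
  case: andP => [[/eqP hyz hyv] _|_] /=; last by rewrite addr0.
  (* Lifting costs 2 only for a set separating v from both neighbours. A set of two or more vertices
     has slack 2, and a single such vertex would be v, which is exempt as X. *)
  suff A2 : (1 < #|A|)%N.
    have := slack AS A2 AnS; rewrite (cut_lift he h1 h2 A) hyz eqxx -hyz hyv /=.
    by clear; cut_lia.
  rewrite ltnNge; apply: contra AX => A1; rewrite XE.
  have /cards1P [u Au] : #|A| == 1%N by rewrite eqn_leq A1 card_gt0.
  move: hyz hyv; rewrite Au !inE => hyz.
  case: (eqVneq (oth s t v e1) u) hyz => [yu /esym/eqP zu|_ _].
    by rewrite yu zu eqxx in hy.
  by rewrite eq_sym; case: (eqVneq v u) => // ->; rewrite eqxx.
have oth_eq e1 e2 : at_vertex s t v e1 -> at_vertex s t v e2 ->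
    oth s t v e1 = oth s t v e2.
  by move=> h1 h2; have := none (e1, e2); rewrite /= h1 h2 => /negbT/negPn/eqP.
have [y [yS vy hy]] := single_neighbor hS S_gt1 vS oth_eq.
have hv0 : (M %| q v - a v + b v)%Z by apply: hX0; rewrite XE inE.
(* Compare the bound for [S :\ v] with that for z0: the targets of S and [S :\ v] agree modulo 2m
   because v has target 0. *)
have cutv : absum a b [set v] <= cut s t [set v].
  have vsub : [set v] \subset S by rewrite sub1set.
  have := hcut (S :\ v); rewrite (cutC hS) // /psum /absum !sumC // !big_set1
    subsetDl.
  have -> : nrm m (\sum_(x in S) (q x - a x + b x) - (q v - a v + b v)) = nrm m
    (p S).
    by apply: eq_nrm; rewrite addrAC subrr add0r rpredN.
  have -> : S :\ v != set0.
    by rewrite -card_gt0; move: S_gt1; rewrite (cardsD1 v) vS.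
  have -> : S :\ v != S by apply/eqP => /setP /(_ v); rewrite !inE eqxx vS.
  have -> : S :\ v != X by rewrite XE; apply/eqP => /setP /(_ v); rewrite !inE
    eqxx.
  by move=> /(_ isT isT isT isT); move: htop; rewrite /absum; cut_lia.
move: cutv; rewrite /absum big_set1 => cutv.
have v2 : (1 < #|[set v; y]|)%N by rewrite cards2 vy.
have vyS : [set v; y] \subset S by rewrite subUset !sub1set vS yS.
(* The edges to y must offset the predirected ones at v, since the full target of v is 0. *)
apply: (merge_single (w := a v - b v) hi vS yS vy hy).
- by have := ha v; have := hb v; cut_lia.
- by have -> : q v - (a v - b v) = q v - a v + b v by ring.
- have := hp [set v]; rewrite sub1set big_set1 => /(_ vS) h1.
  by have := rpredB h1 (dvdz2M hv0); congr (_ %| _)%Z; ring.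
- apply: (IH _ (contract_cert hc vyS _ v2)); last by rewrite !inE eqxx orbT.
  rewrite -addSn leq_add ?nonloops_contract // card_contract //.
  by rewrite !inE eqxx orbT.
Qed.

(** Directing e from u to w and deleting it costs a set that separates them 1 in degree and at most
    1 in [nrm]. Slack 2 pays for this on two or more vertices, which leaves {u} and {w}. The map
    [b'] allows the arcs into z0 to be changed at the same time. *)
Lemma del_step (b' : V -> int) e c : s e != t e ->
  let u := if c then s e else t e in let w := if c then t e else s e in
  (forall x, 0 <= b' x) ->
  absum a b' S <= M - 2 + nrm m (psum q a b' S) ->
  (forall A, A \subset S -> A != set0 -> A != S ->
    M - 2 + nrm m (psum q a b' A) <= cut s t A + absum a b' A) ->
  (forall A, A \subset S -> (1 < #|A|)%N -> A != S ->
    M + nrm m (psum q a b' A) <= cut s t A + absum a b' A) ->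
  M - 1 + nrm m (psum q a b' [set u] - 1) <= cut s t [set u] + absum a b' [set
    u] ->
  M - 1 + nrm m (psum q a b' [set w] + 1) <= cut s t [set w] + absum a b' [set
    w] ->
  solvable m s t S q.
Proof.
move=> nl u w hb' htop' hcut' slack' hu hw; have [hi ha _ _ _ _ _] := hc.
have [hS _ _] := hi.
apply: (del_solvable (e := e) (d := c)).
apply: (IH (a' := a) (b' := b') (X' := set0)).
  by rewrite ltn_add2l (nonloops_del nl).
have hpA A : psum (delq s t q e c) a b' A =
    psum q a b' A - sg c * ((s e \in A)%:Z - (t e \in A)%:Z).
  by rewrite !psumD sum_delq; ring.
have hpA' A : psum (delq s t q e c) a b' A =
    psum q a b' A - (u \in A)%:Z + (w \in A)%:Z.
  by rewrite hpA /u /w /sg; case: (c); ring.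
split=> //.
- exact: del_well_posed.
- by rewrite hpA; have /andP [-> ->] := hS e; rewrite subrr mulr0 subr0.
- by rewrite cards0.
- by move=> x; rewrite inE.
move=> A AS A0 AnS _; rewrite hpA'.
have := cut_del s t e A; have -> : (s e \in A) != (t e \in A) = ((u \in A) !=
  (w \in A)).
  by rewrite /u /w; case: (c) => //; rewrite eq_sym.
have := hcut' A AS A0 AnS.
case: (ltnP 1 #|A|) => A2.
  have := slack' A AS A2 AnS.
  set dl : int := - (u \in A)%:Z + (w \in A)%:Z.
  have -> : psum q a b' A - (u \in A)%:Z + (w \in A)%:Z = psum q a b' A + dl.
    by rewrite /dl addrA.
  have : `|dl| <= 1 by rewrite /dl; case: (u \in A); case: (w \in A).
  have -> : ((u \in A) != (w \in A))%:Z = `|dl| :> int.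
    by rewrite /dl; case: (u \in A); case: (w \in A) => /=; clear; lia.
  have := nrmD m_gt0 (psum q a b' A) dl; have := nrm_le_abs m_gt0 dl.
  by clearbody dl; clear; cut_lia.
have /cards1P [x Ax] : #|A| == 1%N by rewrite eqn_leq A2 card_gt0.
have uw : u != w by rewrite /u /w; case: (c); rewrite // eq_sym.
have e1 (z : int) : z - true%:Z + false%:Z = z - 1 by lia.
have e2 (z : int) : z - false%:Z + true%:Z = z + 1 by lia.
have e3 (z : int) : z - false%:Z + false%:Z = z by lia.
rewrite Ax !inE; case: (eqVneq u x) => [ux|_]; case: (eqVneq w x) => [wx|_] /=.
- by rewrite ux wx eqxx in uw.
- by rewrite e1; move: hu; rewrite ux; clear; cut_lia.
- by rewrite e2; move: hw; rewrite wx; clear; cut_lia.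
- by rewrite e3; clear; cut_lia.
Qed.

End Step.

End Cert.

Section Cert.
Variables (V I : finType) (m : nat).
Implicit Types (s t : I -> V) (A B S X : {set V}) (q : V -> int).
Local Notation M := ((2 * m)%:Z).
Hypothesis m_gt1 : (1 < m)%N.

Let m_gt0 : (0 < m)%N. Proof. exact: ltnW. Qed.

(** * Inductive steps when no target is zero *)

Section Nonzero.
Variables (s t : I -> V) (S : {set V}) (q a b : V -> int) (X : {set V}).
Hypothesis hc : cert m s t S q a b X.
Hypothesis S_gt1 : (1 < #|S|)%N.
Hypothesis IH : forall s' t' S' q' a' b' X',
  (#|S'| + nonloops s' t' < #|S| + nonloops s t)%N ->
  cert m s' t' S' q' a' b' X' -> solvable m s' t' S' q'.
Hypothesis IHab : forall a' b' X',
  absum a' b' S < absum a b S -> cert m s t S q a' b' X' -> solvable m s t S q.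

Local Notation p := (psum q a b).
Local Notation d A := (cut s t A + absum a b A).

Hypothesis slack : forall A, A \subset S -> (1 < #|A|)%N -> A != S ->
  M + nrm m (p A) <= d A.
Hypothesis nonzero : forall x, x \in S -> ~~ (M %| p [set x])%Z.

(** An exceptional vertex has target 0, hence cannot lie in S here. *)
Lemma cut_all A : A \subset S -> A != set0 -> A != S ->
  M - 2 + nrm m (p A) <= d A.
Proof.
move=> AS A0 AnS; apply: (cert_cut hc) => //.
apply/eqP => AX; have := cert_X hc; rewrite -AX => A1.
have /cards1P [x Ax] : #|A| == 1%N by rewrite eqn_leq A1 card_gt0.
have xS : x \in S by rewrite (subsetP AS) // Ax inE.
by have := nonzero xS; rewrite psum1 (cert_X0 hc) // -AX Ax inE.
Qed.

(** Adding the bounds for A and [S :\: A] and comparing with that of z0 shows that twice the cut is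
    at least M - 2 > 0. *)
Lemma cut_edge A : A \subset S -> A != set0 -> A != S ->
  exists e, (s e \in A) != (t e \in A).
Proof.
move=> AS A0 AnS; have [hS _ _] := cert_well_posed hc.
have h1 := cut_all AS A0 AnS.
have A0' : S :\: A != set0.
  by rewrite setD_eq0; apply: contra AnS => h; rewrite eqEsubset AS.
have AnS' : S :\: A != S.
  apply: contra A0 => /eqP h; rewrite -subset0; apply/subsetP => x xA.
  by have := subsetP AS x xA; rewrite -h inE xA.
have := cut_all (subsetDl _ _) A0' AnS'.
have := cert_top hc.
have -> : absum a b (S :\: A) = absum a b S - absum a b A by exact: sumC.
have eqp : psum q a b S = psum q a b A + psum q a b (S :\: A).
  by rewrite /psum sumC // addrCA subrr addr0.
have := nrmD m_gt0 (psum q a b A) (psum q a b (S :\: A)); rewrite -eqp.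
move: h1; rewrite (cutC hS) // => h1 h2 h3 h4.
have cpos : 0 < cut s t A by move: m_gt1 h1 h2 h3 h4; clear; cut_lia.
case: (pickP (fun e => (s e \in A) != (t e \in A))) => [e he|none]; first by
  exists e.
by move: cpos; rewrite /cut big1 // => e _; rewrite none.
Qed.

(** A residue at most m is a demand for outgoing arcs, one at least m a demand for incoming arcs; m
    itself counts as both. *)
Definition res x : int := (psum q a b [set x] %% M)%Z.

Lemma res_bounds x : x \in S -> 1 <= res x <= M - 1.
Proof.
move=> /nonzero; rewrite -(subr0 (p _)) -eqz_mod_dvd mod0z -/(res x) => h.
have h1 : 0 <= res x by rewrite modz_ge0 //; lia.
have h2 : res x < M by rewrite ltz_pmod //; lia.
by lia.
Qed.

Lemma res_dvd x k : (M %| p [set x] + k - (res x + k))%Z.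
Proof. by rewrite -eqz_mod_dvd; apply/eqP; rewrite modzDml. Qed.

Lemma nrm_res x k : x \in S -> `|res x + k| <= m%:Z ->
  nrm m (p [set x] + k) = `|res x + k|.
Proof. by move=> xS h; apply: (nrmE m_gt0 h); apply: res_dvd. Qed.

Lemma nrm_res' x k : x \in S -> `|res x + k - M| <= m%:Z ->
  nrm m (p [set x] + k) = `|res x + k - M|.
Proof.
move=> xS h; apply: (nrmE m_gt0 h).
by rewrite opprB addrCA addrC rpredD ?dvdzz // res_dvd.
Qed.

Lemma single_proper x : x \in S -> [/\ [set x] \subset S, [set x] != set0 &
  [set x] != S].
Proof.
move=> xS; rewrite sub1set xS -card_gt0 cards1; split=> //.
by apply: contraTneq S_gt1 => <-; rewrite cards1.
Qed.

Lemma cut_single x : x \in S -> M - 2 + nrm m (p [set x]) <= d [set x].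
Proof. by move=> /single_proper [h1 h2 h3]; apply: cut_all. Qed.

Lemma nrm_res0 x : x \in S -> nrm m (p [set x]) =
  if res x <= m%:Z then res x else M - res x.
Proof.
move=> xS; have := res_bounds xS => hr; rewrite -[p _]addr0; case: ifP => h.
  by rewrite nrm_res //; lia.
by rewrite nrm_res' //; lia.
Qed.

(** The chosen direction lowers [nrm] by 1 at both ends, exactly as much as their degrees. *)
Lemma forced_step e c : s e != t e ->
  res (if c then s e else t e) <= m%:Z -> m%:Z <= res (if c then t e else s e) ->
  solvable m s t S q.
Proof.
move=> nl hu hw; have [hi ha hb htop _ _ _] := hc; have [hS _ _] := hi.
apply: (del_step m_gt1 hc S_gt1 IH nl (b' := b) (c := c)) => //.
- exact: cut_all.
- set u := if c then s e else t e in hu *.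
  have uS : u \in S by rewrite /u; have /andP [] := hS e; case: (c).
  have := cut_single uS; have hr := res_bounds uS.
  rewrite (nrm_res0 uS) hu (nrm_res (k := -1) uS); last by lia.
  by move: hr hu; clear; cut_lia.
- set w := if c then t e else s e in hw *.
  have wS : w \in S by rewrite /w; have /andP [] := hS e; case: (c).
  have := cut_single wS; have hr := res_bounds wS.
  rewrite (nrm_res0 wS) (nrm_res' (k := 1) wS); last by lia.
  by case: ifP => _; move: hr hw; clear; cut_lia.
Qed.

(* Here no edge can be deleted for free.  Adding edges from x to z0 raises the
   target of x to m, that is -m modulo 2m; then x accepts an incoming edge. *)
Lemma strict_pos : (forall x, x \in S -> res x < m%:Z) -> solvable m s t S q.
Proof.
move=> hpos; have [hi ha hb htop hX hX0 hcut] := hc; have [hS hq hp] := hi.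
case: (pickP (fun x => (x \in S) && (0 < b x))) => [x /andP [xS bx]|bz].
  (* Drop an arc from x to z0: since the residue of x is below m, its [nrm] decreases together with
     its degree. The graph stays and [absum] decreases. *)
  pose b' y := b y - (x == y)%:Z.
  have eqp A : psum q a b' A = psum q a b A - (x \in A)%:Z.
    by rewrite !psumD sumrB sum_indic addrA.
  have eqab A : absum a b' A = absum a b A - (x \in A)%:Z.
    by rewrite !absumD sumrB sum_indic addrA.
  apply: (IHab (a' := a) (b' := b') (X' := set0)).
    by rewrite eqab xS; clear; cut_lia.
  split=> //.
  - by move=> y; rewrite /b'; case: eqP => [<-|_]; have := hb y; lia.
  - rewrite eqab eqp; have -> : (x \in S)%:Z = 1%:Z :> int by rewrite xS.
    have := nrmD m_gt0 (psum q a b S - 1%:Z) 1%:Z; rewrite subrK.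
    have := nrm_le_abs m_gt0 1%:Z; move: htop; clear; cut_lia.
  - by rewrite cards0.
  - by move=> y; rewrite inE.
  move=> A AS A0 AnS _; rewrite eqab eqp.
  case: (boolP (x \in A)) => xA; last by rewrite !subr0; apply: cut_all.
  rewrite -[true%:Z]/(1%:Z).
  case: (ltnP 1 #|A|) => A2.
    have := slack AS A2 AnS; have := nrmD m_gt0 (psum q a b A) (- 1%:Z).
    have := nrm_le_abs m_gt0 (- 1%:Z); clear; cut_lia.
  have Ax : A = [set x].
    by apply/esym/eqP; rewrite eqEcard sub1set xA cards1.
  have hr := res_bounds xS; have hx := hpos x xS; have := cut_single xS.
  rewrite Ax (nrm_res0 xS) (ltW hx) (nrm_res (k := - 1%:Z) xS); last by lia.
  by move: hr hx; clear; cut_lia.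
have bS : \sum_(x in S) b x = 0.
  apply: big1 => x xS; have := bz x; rewrite xS /= => /negbT.
  by have := hb x; lia.
set al : int := \sum_(x in S) a x.
have al0 : 0 <= al by apply: sumr_ge0.
have abE : absum a b S = al by rewrite absumD bS addr0.
have pE : (M %| psum q a b S + al)%Z.
  by rewrite psumD bS addr0 subrK.
have hal : al <= M - 2 + nrm m al.
  by move: htop; rewrite abE (eq_nrm (y := - al)) ?nrmN ?opprK.
have [x xS] : exists x, x \in S by apply/card_gt0P; apply: ltnW.
have [x1 x2 x3] := single_proper xS.
have [e he] := cut_edge x1 x2 x3.
have nl : s e != t e by apply: contraNneq he => ->.
pose c := t e == x.
have wx : (if c then t e else s e) = x.
  move: he; rewrite !inE /c; case: (eqVneq (t e) x) => // _.
  by rewrite eqbF_neg negbK => /eqP.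
set u := if c then s e else t e.
have uS : u \in S by rewrite /u; have /andP [] := hS e; case: (c).
have ux : u != x by rewrite -wx /u; case: (c); rewrite // eq_sym.
have hr := res_bounds xS; have hx := hpos x xS.
have hru := res_bounds uS; have hu := hpos u uS.
(* The j extra arcs raise the degree of x and its [nrm] alike, up to [nrm] m; [nrm_switch] takes
   care of z0. *)
pose j : int := m%:Z - res x.
have hj : 1 <= j <= m%:Z - 1 by move: hr hx; rewrite /j; clear; lia.
have j0 : 0 <= j by move: hj; case/andP => hj _; apply: le_trans hj.
pose b' y := b y + j * (x == y)%:Z.
have eqp A : psum q a b' A = psum q a b A + j * (x \in A)%:Z.
  by rewrite !psumD big_split /= -mulr_sumr sum_indic addrA.
have eqab A : absum a b' A = absum a b A + j * (x \in A)%:Z.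
  by rewrite !absumD big_split /= -mulr_sumr sum_indic addrA.
apply: (del_step m_gt1 hc S_gt1 IH nl (b' := b') (c := c)).
- by move=> y; rewrite /b' addr_ge0 // mulr_ge0.
- rewrite eqab eqp xS -[true%:Z]/(1%:Z) mulr1 abE (eq_nrm (y := j - al)); first
    exact: nrm_switch.
  by rewrite opprB addrACA subrr addr0.
- move=> A AS A0 AnS; rewrite eqab eqp; have := cut_all AS A0 AnS.
  have := nrmD m_gt0 (psum q a b A) (j * (x \in A)%:Z).
  have := nrm_le_abs m_gt0 (j * (x \in A)%:Z).
  case: (x \in A); rewrite -1?[true%:Z]/(1%:Z) -1?[false%:Z]/(0%:Z) ?mulr1
    ?mulr0 ?addr0; move: hj; clear; cut_lia.
- move=> A AS A2 AnS; rewrite eqab eqp; have := slack AS A2 AnS.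
  have := nrmD m_gt0 (psum q a b A) (j * (x \in A)%:Z).
  have := nrm_le_abs m_gt0 (j * (x \in A)%:Z).
  case: (x \in A); rewrite -1?[true%:Z]/(1%:Z) -1?[false%:Z]/(0%:Z) ?mulr1
    ?mulr0 ?addr0; move: hj; clear; cut_lia.
- rewrite -/u eqab eqp inE eq_sym (negPf ux) mulr0 !addr0.
  have := cut_single uS; rewrite (nrm_res0 uS) (ltW hu) (nrm_res (k := - 1%:Z)
    uS).
    by move: hru hu; clear; cut_lia.
  by move: hru hu; clear; lia.
- rewrite wx eqab eqp inE eqxx -[true%:Z]/(1%:Z) mulr1 -[psum q a b [set x] + j
    + 1]addrA.
  have := cut_single xS; rewrite (nrm_res0 xS) (ltW hx) (nrm_res' (k := j + 1)
    xS).
    by move: hr hx; rewrite /j; clear; cut_lia.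
  by move: hr hx; rewrite /j; clear; lia.
Qed.

End Nonzero.

Lemma netN s t (o : I -> bool) x : net s t (fun e => ~~ o e) x = - net s t o x.
Proof. by rewrite /net -sumrN; apply: eq_bigr => e _; case: (o e); rewrite /sg
  /=; ring. Qed.

Lemma solvableN s t S q q' : (forall x, q' x = - q x) ->
  solvable m s t S q' -> solvable m s t S q.
Proof.
move=> hq' [o ho]; exists (fun e => ~~ o e) => x /ho.
by rewrite netN hq' opprK -opprD rpredN.
Qed.

Lemma certN s t S q q' (a b : V -> int) X : (forall x, q' x = - q x) ->
  cert m s t S q a b X -> cert m s t S q' b a X.
Proof.
move=> hq'.
have sumN A : \sum_(x in A) q' x = - \sum_(x in A) q x.
  by rewrite -sumrN; apply: eq_bigr.
have eqp A : psum q' b a A = - psum q a b A by rewrite !psumD sumN; ring.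
have eqab A : absum b a A = absum a b A by rewrite !absumD addrC.
case=> [[hS hq hp] ha hb htop hX hX0 hcut]; split=> //.
- split=> // [|A /hp]; first by rewrite sumN rpredN.
  move=> /dvd2P [k hk]; apply/dvd2P; exists (- k - cut s t A).
  by rewrite sumN mulrBl mulNr -hk; ring.
- by rewrite eqp eqab nrmN.
- by move=> x /hX0; rewrite -rpredN hq'; congr (_ %| _)%Z; ring.
- by move=> A h1 h2 h3 h4; rewrite eqp eqab nrmN //; apply: hcut.
Qed.

Theorem cert_solvable s t S q (a b : V -> int) X :
  cert m s t S q a b X -> solvable m s t S q.
Proof.
have [n] := ubnP (#|S| + nonloops s t); elim: n s t S q a b X => // n IHn.
move=> s t S q a b X; rewrite ltnS => hn hc.
(* A second induction, on the number of arcs at z0, serves the step that only drops such an arc. *)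
have [k] : exists k : nat, absum a b S < k%:Z.
  by exists `|absum a b S|.+1; clear; cut_lia.
elim: k a b X hc => [|k IHk] a b X hc hk.
  suff : 0 <= absum a b S by rewrite leNgt hk.
  by apply: sumr_ge0 => x _; rewrite addr_ge0 ?(cert_a hc) ?(cert_b hc).
have hi := cert_well_posed hc.
case: (leqP #|S| 1) => S1; first exact: solve_small hi.
have IH s' t' S' q' a' b' X' : (#|S'| + nonloops s' t' < #|S| + nonloops s t)%N ->
    cert m s' t' S' q' a' b' X' -> solvable m s' t' S' q'.
  by move=> h; apply: IHn; apply: leq_trans hn.
have IHab a' b' X' : absum a' b' S < absum a b S -> cert m s t S q a' b' X' ->
    solvable m s t S q.
  by move=> h h'; apply: IHk h' _; move: h hk; clear; cut_lia.
case: (pickP (fun A => [&& A \subset S, (1 < #|A|)%N, A != S &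
    cut s t A + absum a b A < M + nrm m (psum q a b A)])) => [A|none].
  by case/and4P => AS A2 AnS tight; apply: (tight_step m_gt1 hc S1 IH AS A2 AnS
    tight).
have slack A : A \subset S -> (1 < #|A|)%N -> A != S ->
    M + nrm m (psum q a b A) <= cut s t A + absum a b A.
  by move=> h1 h2 h3; have := none A; rewrite h1 h2 h3 /= ltNge => /negbFE.
case: (pickP (fun x => (x \in S) && (M %| psum q a b [set x])%Z)) => [x|nz].
  case/andP => xS; rewrite psum1 => hx.
  (* If no exceptional vertex lies in S, the bounds hold for all proper nonempty sets and x may be
     declared exceptional; otherwise the one present is used. *)
  case: (set_0Vmem (S :&: X)) => [SX0|[v]].
    apply: (@zero_step _ _ m m_gt1 s t S q a b [set x] _ S1 IH slack x xS) => //.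
    have [_ ha hb htop _ _ hcut] := hc; split=> //; first by rewrite cards1.
      by move=> y; rewrite inE => /eqP ->.
    move=> A AS A0 AnS _; apply: hcut => //; apply: contra A0 => /eqP AX.
    by rewrite -SX0 AX (setIidPr _) // -AX.
  rewrite inE => /andP [vS vX]; apply: (zero_step m_gt1 hc S1 IH slack vS).
  by apply/esym/eqP; rewrite eqEcard sub1set vX cards1 (cert_X hc).
have nonzero x : x \in S -> ~~ (M %| psum q a b [set x])%Z.
  by move=> xS; have := nz x; rewrite xS /= => ->.
have hr := res_bounds S1 nonzero.
set r := res q a b in hr.
case: (pickP (fun ec : I * bool => let: (e, c) := ec in
    [&& s e != t e, r (if c then s e else t e) <= m%:Z &
     m%:Z <= r (if c then t e else s e)])) => [[e c] /and3P [h1 h2 h3]|noforced].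
  exact: (forced_step hc S1 IH slack nonzero h1 h2 h3).
have forced e u w : s e != t e -> ((u == s e) && (w == t e)) || ((u == t e) &&
  (w == s e)) ->
    r u <= m%:Z -> m%:Z <= r w -> False.
  move=> nl /orP [] /andP [/eqP -> /eqP ->] h1 h2.
    by have := noforced (e, true); rewrite nl h1 h2.
  by have := noforced (e, false); rewrite nl h1 h2.
have [hS _ _] := hi.
have edge A : A \subset S -> A != set0 -> A != S ->
    exists u w e, [/\ u \in A, w \in S :\: A, s e != t e &
      ((u == s e) && (w == t e)) || ((u == t e) && (w == s e))].
  move=> h1 h2 h3; have [e he] := cut_edge hc nonzero h1 h2 h3.
  have nl : s e != t e by apply: contraNneq he => ->.
  have /andP [k1 k2] := hS e.
  case: (boolP (s e \in A)) he => h; case: (boolP (t e \in A)) => h' // _.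
    by exists (s e), (t e), e; rewrite !inE h h' k2 !eqxx.
  by exists (t e), (s e), e; rewrite !inE h h' k1 !eqxx orbT.
(* An edge leaving N would be of the kind handled by [forced_step], so by [cut_edge] N is empty or
   S. *)
pose N := [set x in S | m%:Z <= r x].
have NS : N \subset S by apply/subsetP => x; rewrite inE => /andP [].
case: (eqVneq N set0) => [N0|N0].
  apply: (strict_pos hc S1 IH IHab slack nonzero) => x xS.
  by have := in_set0 x; rewrite -N0 inE xS /= => /negbT; rewrite -ltNge.
case: (eqVneq N S) => [NE|NnS]; last first.
  have [u [w [e [uN]]]] := edge N NS N0 NnS.
  rewrite !inE negb_and => /andP [hw wS] nl ends; rewrite wS /= -ltNge in hw.
  have uN' : m%:Z <= r u by move: uN; rewrite inE => /andP [].
  case: (@forced e w u nl _ (ltW hw) uN').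
  by move: ends; rewrite orbC andbC [X in _ || X]andbC.
have geN x : x \in S -> m%:Z <= r x by rewrite -{1}NE inE => /andP [].
(* All residues are now at least m; at a vertex with residue m every edge would be forced. *)
pose P := [set x in S | r x <= m%:Z].
have PS : P \subset S by apply/subsetP => x; rewrite inE => /andP [].
case: (set_0Vmem P) => [P0|[x]].
  (* All residues exceed m; reversing all arcs, those at z0 included, brings them below m. *)
  apply: (solvableN (q' := fun x => - q x)) => //.
  have hc' : cert m s t S (fun x => - q x) b a X by apply: certN hc.
  have eqp A : psum (fun x => - q x) b a A = - psum q a b A.
    by rewrite !psumD sumrN; ring.
  have eqab a' b' A : absum a' b' A = absum b' a' A by rewrite !absumD addrC.
  apply: (strict_pos hc' S1 IH).
  - move=> a' b' X'; rewrite [absum b a S]eqab [absum a' _ _]eqab => h1 h2.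
    apply: (solvableN (q' := q)) => [x|]; first by rewrite opprK.
    by apply: IHab h1 _; apply: certN h2 => x; rewrite opprK.
  - by move=> A; rewrite eqp eqab nrmN //; apply: slack.
  - by move=> x; rewrite eqp rpredN; apply: nonzero.
  - move=> x xS; have := in_set0 x; rewrite -P0 inE xS /= => /negbT; rewrite
      -ltNge => h.
    have hx := hr x xS; rewrite /res eqp.
    suff -> : (- psum q a b [set x] %% M)%Z = M - r x by move: h; clear; lia.
    rewrite -[RHS](@modz_small _ M); last by move: hx; clear; lia.
    apply/eqP; rewrite eqz_mod_dvd -rpredN opprB opprK addrAC -addrA rpredD
      ?dvdzz //.
    by rewrite -eqz_mod_dvd modz_mod.
rewrite inE => /andP [xS xP].
have [x1 x2 x3] := single_proper S1 xS.
have [u [w [e [uN]]]] := edge _ x1 x2 x3.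
rewrite inE => /andP [hw wS] nl ends.
move: uN; rewrite inE => /eqP uN; rewrite -uN in xP.
by case: (forced e u w nl ends xP (geN _ wS)).
Qed.

End Cert.

(** * Orientations when all odd cuts are large *)

Section Odd.
Variables (V I : finType) (m : nat).
Implicit Types (s t : I -> V) (A B S X : {set V}) (q : V -> int).
Local Notation M := ((2 * m)%:Z).
Hypothesis m_gt1 : (1 < m)%N.

Let m_gt0 : (0 < m)%N. Proof. exact: ltnW. Qed.

(** When all targets are multiples of m, a set is even or odd according to whether M divides its
    target sum; odd sums are m modulo 2m. *)
Lemma odd_multiple (x : int) : (m%:Z %| x)%Z -> ~~ (M %| x)%Z -> (M %| x -
  m%:Z)%Z.
Proof.
move=> /dvdzP [i ->].
have [k [] ->] : exists k : int, i = k * 2 \/ i = k * 2 + 1.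
- by exists (i %/ 2)%Z; lia.
- by rewrite PoszM -mulrA dvdz_mull ?dvdzz.
- by move=> _; rewrite PoszM mulrDl mul1r addrK -mulrA dvdz_mull ?dvdzz.
Qed.

Lemma odd_add (x y : int) : (m%:Z %| x)%Z -> (m%:Z %| y)%Z ->
  ~~ (M %| x)%Z -> ~~ (M %| y)%Z -> (M %| x + y)%Z.
Proof.
move=> hx hy h1 h2; have := rpredD (odd_multiple hx h1) (odd_multiple hy h2).
move=> h; have := rpredD h (dvdzz M); congr (_ %| _)%Z; rewrite PoszM; ring.
Qed.

Lemma even_add (x y : int) : (M %| x)%Z -> (M %| x + y)%Z = (M %| y)%Z.
Proof.
move=> hx; apply/idP/idP => h; last exact: rpredD.
by have := rpredB h hx; rewrite addrAC subrr add0r.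
Qed.

Section Uncross.
Variables (s t : I -> V) (S : {set V}) (q : V -> int).
Hypothesis hi : well_posed m s t S q.
Hypothesis hq : forall x, x \in S -> (m%:Z %| q x)%Z.
Hypothesis hcut : forall A, A \subset S -> ~~ (M %| \sum_(x in A) q x)%Z ->
  3 * m%:Z - 2 <= cut s t A.

Lemma sum_mult A : A \subset S -> (m%:Z %| \sum_(x in A) q x)%Z.
Proof. by move=> AS; apply: rpred_sum => x xA; apply: hq; apply: (subsetP AS).
  Qed.

Lemma sumID A B : \sum_(x in A) q x = \sum_(x in A :&: B) q x + \sum_(x in A
  :\: B) q x.
Proof. exact: big_setID. Qed.

(** These sets obstruct lifting an edge from v to y together with an edge from v into A: their cut
    would fall below the lower bound. *)
Definition tight y v A := [&& A \subset S, y \in A, v \notin A,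
  ~~ (M %| \sum_(x in A) q x)%Z & cut s t A <= 3 * m%:Z - 2].

Lemma odd_cut_gap A : A \subset S -> ~~ (M %| \sum_(x in A) q x)%Z ->
  cut s t A < 3 * m%:Z -> cut s t A <= 3 * m%:Z - 2.
Proof.
move=> AS oA h; have [_ _ /(_ A AS) h1] := hi.
have := rpredB (dvdz2M (odd_multiple (sum_mult AS) oA)) h1.
rewrite (_ : _ - _ = cut s t A - m%:Z); last by ring.
by move=> /dvd2P [k]; move: h; clear; cut_lia.
Qed.

(** If the intersection is odd, so is the union, and submodularity applies. Otherwise both
    differences are odd, and e, which crosses A and B but neither difference, makes one of their
    cuts too small. *)
Lemma tightU e v A B : at_vertex s t v e ->
  tight (oth s t v e) v A -> tight (oth s t v e) v B ->
  tight (oth s t v e) v (A :|: B).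
Proof.
move=> he /and5P [AS yA vA oA tA] /and5P [BS yB vB oB tB].
have ABS : A :&: B \subset S by rewrite subIset ?AS.
have U1 : (A :|: B) :&: B = B by apply/setIidPr; apply: subsetUr.
have U2 : (A :|: B) :\: B = A :\: B by rewrite setDUl setDv setU0.
have sumU : \sum_(x in A :|: B) q x + \sum_(x in A :&: B) q x =
    \sum_(x in A) q x + \sum_(x in B) q x.
  by rewrite (sumID (A :|: B) B) U1 U2 (sumID A B); ring.
have eU : (M %| \sum_(x in A :|: B) q x + \sum_(x in A :&: B) q x)%Z.
  by rewrite sumU odd_add ?sum_mult.
have cut1 : cut s t (A :|: B) + cut s t (A :&: B) <= cut s t A + cut s t B.
  rewrite /cut -!big_split /=; apply: ler_sum => i _; rewrite !inE.
  by move: (s i \in A) (s i \in B) (t i \in A) (t i \in B) => [] [] [] [].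
have cut2 : cut s t (A :\: B) + cut s t (B :\: A) + 2 <= cut s t A + cut s t B.
  rewrite /cut -!big_split /= (bigD1 e) //= [in X in _ <= X](bigD1 e) //=.
  rewrite [X in X <= _]addrAC; apply: lerD; last first.
    apply: ler_sum => i _; rewrite !inE.
    by move: (s i \in A) (s i \in B) (t i \in A) (t i \in B) => [] [] [] [].
  move: he yA yB; rewrite /at_vertex /oth !inE.
  case: (eqVneq (s e) v) => [-> _ -> ->|_ /= /eqP -> -> ->];
    by rewrite (negPf vA) (negPf vB).
have US : A :|: B \subset S by rewrite subUset AS.
rewrite /tight US !inE yA negb_or vA vB /=.
case: (boolP (M %| \sum_(x in A :&: B) q x)%Z) => hI.
  have oAD : ~~ (M %| \sum_(x in A :\: B) q x)%Z.
    by move: oA; rewrite (sumID A B) even_add.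
  have oBD : ~~ (M %| \sum_(x in B :\: A) q x)%Z.
    by move: oB; rewrite (sumID B A) setIC even_add.
  have := hcut (subset_trans (subsetDl _ _) AS) oAD.
  have := hcut (subset_trans (subsetDl _ _) BS) oBD.
  by move: cut2 tA tB; clear; cut_lia.
have oU : ~~ (M %| \sum_(x in A :|: B) q x)%Z.
  by apply: contra hI => h; rewrite even_add in eU.
rewrite oU /=; have := hcut ABS hI.
by move: cut1 tA tB; clear; cut_lia.
Qed.

(** If A contained all neighbours of v, adding v would lower the cut by the degree of v, which is
    even and positive, and leave the set odd. *)
Lemma escape e v A : at_vertex s t v e -> (M %| q v)%Z -> v \in S ->
  tight (oth s t v e) v A ->
  exists2 e', at_vertex s t v e' & oth s t v e' \notin A.
Proof.
move=> he qv vS /and5P [AS yA vA oA tA].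
case: (pickP (fun e' => at_vertex s t v e' && (oth s t v e' \notin A))).
  by move=> e' /andP [h1 h2]; exists e'.
move=> none.
have cutU : cut s t (v |: A) + cut s t [set v] <= cut s t A.
  rewrite /cut -big_split /=; apply: ler_sum => i _; rewrite !inE.
  have := none i; rewrite /at_vertex /oth.
  case: (eqVneq (s i) v) => [->|_]; case: (eqVneq (t i) v) => [->|_] //=;
    rewrite ?(negPf vA) //; by [move/negbFE => ->|case: (_ \in A); case: (_ \in
      A)].
have vAS : v |: A \subset S by rewrite subUset sub1set vS.
have oU : ~~ (M %| \sum_(x in v |: A) q x)%Z by rewrite big_setU1 // even_add.
have cv1 : 0 < cut s t [set v].
  apply: (lt_le_trans (y := ((s e \in [set v]) != (t e \in [set v]))%:Z)).
    by move: he; rewrite /at_vertex !inE; case: (_ == v); case: (_ == v).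
  by rewrite /cut (bigD1 e) //= lerDl sumr_ge0.
have [hS _ hp] := hi.
have /dvd2P [k hk] : (2 %| cut s t [set v])%Z.
  have := hp [set v]; rewrite sub1set big_set1 => /(_ vS) h.
  by have := rpredB (dvdz2M qv) h; rewrite opprB addrCA subrr addr0.
have := hcut vAS oU; move: cutU cv1 hk tA; clear; cut_lia.
Qed.

(* Otherwise a maximal tight odd set A containing the first neighbour and not v
   contains all the neighbours of v, and adding v to A gives an odd set with too
   small a cut. *)
Lemma liftable e v : v \in S -> (M %| q v)%Z -> at_vertex s t v e ->
  (exists2 e', at_vertex s t v e' & oth s t v e' != oth s t v e) ->
  exists e', [/\ at_vertex s t v e', oth s t v e' != oth s t v e &
    forall A, tight (oth s t v e) v A -> oth s t v e' \notin A].
Proof.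
move=> vS qv he [e0 he0 hy0].
case: (pickP (tight (oth s t v e) v)) => [A0 hA0|none]; last first.
  by exists e0; split=> // A; rewrite none.
case: (arg_maxnP (fun A : {set V} => #|A|) hA0) => A hA maxA.
have [e' he' hA'] := escape he qv vS hA.
exists e'; split=> //.
  by apply: contraNneq hA' => ->; case/and5P: hA.
move=> B hB; apply: contra hA' => zB.
have := maxA _ (tightU he hA hB) => hle.
have /eqP -> : A == A :|: B by rewrite eqEcard subsetUl.
by rewrite inE zB orbT.
Qed.

End Uncross.

Theorem odd_solvable s t S q : well_posed m s t S q ->
  (forall x, x \in S -> (m%:Z %| q x)%Z) ->
  (forall A, A \subset S -> ~~ (M %| \sum_(x in A) q x)%Z ->
    3 * m%:Z - 2 <= cut s t A) ->
  solvable m s t S q.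
Proof.
have [n] := ubnP (#|S| + nonloops s t); elim: n s t S q => // n IHn.
move=> s t S q; rewrite ltnS => hn hi hq hcut.
case: (leqP #|S| 1) => S1; first exact: solve_small hi.
have [hS hqS hp] := hi.
have merge A a0 : A \subset S -> a0 \in A -> (1 < #|A|)%N ->
    solvable m (contract A a0 \o s) (contract A a0 \o t) (contract A a0 @: S)
      (fiber_sum S (contract A a0) q).
  move=> AS a0A A2; apply: IHn.
  - apply: leq_trans hn; rewrite -addSn leq_add ?nonloops_contract //
      card_contract //.
  - exact: contract_well_posed.
  - move=> x _; apply: rpred_sum => u /andP [uS _]; exact: hq.
  - move=> B BS; rewrite sum_fiber_sum (cut_contract _ _ hS); apply: hcut.
    by apply/subsetP => u; rewrite inE => /andP [].
case: (pickP (fun v => (v \in S) && (M %| q v)%Z)) => [v /andP [vS qv]|noeven].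
  case: (pickP (fun e : I * I => [&& at_vertex s t v e.1, at_vertex s t v e.2 &
      oth s t v e.1 != oth s t v e.2])) => [[e1 e0] /= /and3P [h1 h0 hy]|none].
    have [|e2 [h2 hy2 hA2]] := @liftable s t S q hi hq hcut e1 v vS qv h1.
      by exists e0; rewrite // eq_sym.
    have he : e1 != e2 by apply: contraNneq hy2 => ->.
    apply: (lift_solvable he h1 h2); apply: IHn => //.
    - by apply: leq_trans hn; rewrite ltn_add2l nonloops_lift.
    - exact: lift_well_posed.
    move=> A AS oA; have := hcut A AS oA; rewrite (cut_lift he h1 h2 A).
    case: andP => [[/eqP hyz hyv] _|_] /=; last by rewrite addr0.
    (* A set that loses 2 separates v from both neighbours. If its cut is below 3m, then A or its
       complement, which is odd as well, contradicts the choice of [e2]. *)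
    suff : 3 * m%:Z <= cut s t A.
      by rewrite (cut_lift he h1 h2 A) hyz eqxx -hyz hyv /=; clear; cut_lia.
    rewrite leNgt; apply/negP => /(odd_cut_gap hi hq AS oA) tA.
    have oth_S e : oth s t v e \in S.
      by rewrite /oth; case: ifP => _; have /andP [] := hS e.
    case: (boolP (v \in A)) => vA; rewrite ?vA ?(negPf vA) in hyv.
      have yA : oth s t v e1 \notin A by case: (_ \in A) hyv.
      have := hA2 (S :\: A); rewrite !inE oth_S -hyz yA /tight subsetDl !inE vA
        yA oth_S.
      rewrite (cutC hS) // tA /= andbT => /(_ _)/negP; apply => //.
      by rewrite sumC // even_add // rpredN.
    have yA : oth s t v e1 \in A by case: (_ \in A) hyv.
    have := hA2 A; rewrite -hyz yA /tight AS yA vA oA tA => /(_ isT).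
    by [].
  have oth_eq e1 e2 : at_vertex s t v e1 -> at_vertex s t v e2 ->
      oth s t v e1 = oth s t v e2.
    by move=> h1 h2; have := none (e1, e2); rewrite /= h1 h2 => /negbT/negPn/eqP.
  have [y [yS vy hy]] := single_neighbor hS S1 vS oth_eq.
  apply: (merge_single (w := 0) hi vS yS vy hy).
  - by rewrite normr0 cut_ge0.
  - by rewrite subr0.
  - have := hp [set v]; rewrite sub1set big_set1 => /(_ vS) h.
    by have := rpredB h (dvdz2M qv); rewrite addrAC subrr.
  - apply: merge; last by rewrite cards2 vy.
      by rewrite subUset !sub1set vS yS.
    by rewrite !inE eqxx orbT.
have odd x : x \in S -> ~~ (M %| q x)%Z by move=> xS; have := noeven x; rewrite
  xS /= => ->.
pose z (x : V) : int := 0.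
have p0 q' A : psum q' z z A = \sum_(x in A) q' x.
  by apply: eq_bigr => x _; rewrite subr0 addr0.
have a0 A : absum z z A = 0 by apply: big1 => x _; rewrite addr0.
pose bad A := [&& A \subset S, A != set0, A != S &
  cut s t A < M - 2 + nrm m (\sum_(x in A) q x)].
case: (pickP bad) => [A0 hA0|nobad]; last first.
  apply: (@cert_solvable _ _ m m_gt1 s t S q z z set0); split=> //.
  - by rewrite a0 p0 addr_ge0 ?nrm_ge0 //; move: m_gt1; clear; lia.
  - by rewrite cards0.
  - by move=> x; rewrite inE.
  move=> A AS A0 AnS _; have := nobad A; rewrite /bad AS A0 AnS /= a0 p0 addr0
    => /negbT.
  by rewrite -leNgt.
case: (arg_minnP (fun A : {set V} => #|A|) hA0) => A hA minA {A0 hA0}.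
case/and4P: (hA) => AS A0 AnS low.
(* The threshold [M - 2 + nrm] never exceeds 3m - 2, so an odd set is not bad. *)
have eA : (M %| \sum_(x in A) q x)%Z.
  apply/negPn/negP => oA; have := hcut A AS oA.
  by have := nrm_max m_gt0 (\sum_(x in A) q x); move: low; clear; cut_lia.
have A2 : (1 < #|A|)%N.
  rewrite ltnNge; apply/negP => A1.
  have /cards1P [x Ax] : #|A| == 1%N by rewrite eqn_leq A1 card_gt0.
  move: eA AS; rewrite Ax big_set1 sub1set => h xS.
  by have := odd x xS; rewrite h.
have [a a0A] := set0Pn _ A0.
(* The contracted graph, where A has target 0, falls under the induction hypothesis; minimality of A
   provides the certificate for the inside. *)
have [o1 h1 h2] := contract_solution hS AS a0A (merge A a AS a0A A2).
apply: (glue (a0 := a) hS AS h1).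
apply: (cert_solvable m_gt1 (inner_cert (a := z) (b := z) (X := set0) hi _ _ AS
  a0A h2 _ _ _ _)) => //.
- by rewrite cards0.
- by move=> x; rewrite inE.
- by rewrite a0 addr0 p0; apply: ltW.
move=> B BA B0 BnA _; rewrite a0 addr0 p0 leNgt; apply/negP => lowB.
have BpA : B \proper A by rewrite properEneq BnA.
have := proper_card BpA; rewrite ltnNge minA // /bad (subset_trans BA AS) B0
  lowB andbT /=.
by apply: contra BnA => /eqP BS; rewrite eqEsubset BA BS AS.
Qed.

End Odd.

(** * Tensions of planar maps with values in a finite abelian group *)

Lemma sub_swap (K : zmodType) (a b c d : K) : a - b = c - d -> a - c = b - d.
Proof. by move=> h; rewrite -(subrKA b) h addrC subrKA. Qed.

Section Rep.
Variables (D : finType) (r : {perm D}).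

(** Functions on vertices or faces are handled as functions on darts, read at the representative of
    the orbit. *)
Definition rep x := odflt x [pick y in porbit r x].

Lemma mem_rep x : rep x \in porbit r x.
Proof. by rewrite /rep; case: pickP => [y //|/(_ x)]; rewrite porbit_id. Qed.

Lemma porbit_rep x : porbit r (rep x) = porbit r x.
Proof. by apply/eqP; rewrite eq_porbit_mem mem_rep. Qed.

Lemma eq_rep x y : porbit r x = porbit r y -> rep x = rep y.
Proof.
move=> e; rewrite /rep -e; case: pickP => [z //|/(_ x)].
by rewrite porbit_id.
Qed.

Lemma rep_id x : rep (rep x) = rep x.
Proof. by apply: eq_rep; rewrite porbit_rep. Qed.

Lemma porbit_next x : porbit r (r x) = porbit r x.
Proof. by have := porbit_perm r 1 x; rewrite expg1. Qed.

Lemma card_reps : #|[set x | rep x == x]| = #|porbits r|.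
Proof.
have -> : porbits r = porbit r @: [set x | rep x == x].
  apply/setP => B; apply/imsetP/imsetP => [[x _ ->]|[x _ ->]]; last by exists x.
  by exists (rep x); rewrite ?inE ?rep_id ?porbit_rep.
rewrite card_in_imset // => x y; rewrite !inE => /eqP <- /eqP <- h.
by apply: eq_rep; rewrite -porbit_rep h porbit_rep.
Qed.

Variable adj : rel D.
Hypothesis adj_sym : connect_sym adj.
Hypothesis adj_r : forall x, connect adj x (r x).

Lemma root_rep x : fingraph.root adj (rep x) = fingraph.root adj x.
Proof.
apply/eqP; rewrite root_connect // adj_sym; have /porbitP [i ->] := mem_rep x.
elim: i => [|i IH]; first by rewrite perm1.
by rewrite expgSr permM (connect_trans IH).
Qed.

(** One orbit per component is left out: a potential is normalized to 0 there, and the face sum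
    there is determined by the others. *)
Definition nonroots := [set x | (rep x == x) && (x != rep (fingraph.root adj x))].

Lemma card_nonroots : #|porbits r| = (#|nonroots| + n_comp adj predT)%N.
Proof.
rewrite -card_reps -(cardsID [set x | x != rep (fingraph.root adj x)]); congr
  addn.
  by apply: eq_card => x; rewrite !inE.
have -> : n_comp adj predT = #|[set x | fingraph.root adj x == x]|.
  by apply: eq_card => x; rewrite !inE andbT.
rewrite -(@card_in_imset _ _ rep [set x | fingraph.root adj x == x]); last first.
  move=> x y; rewrite !inE => /eqP hx /eqP hy h.
  by rewrite -hx -hy -root_rep h root_rep.
apply: eq_card => x; rewrite !inE negbK; apply/andP/imsetP.
  case=> /eqP h _; exists (fingraph.root adj x); last exact: h.
  by rewrite inE (root_root adj_sym).
case=> y; rewrite inE => /eqP hy ->; split; last by rewrite rep_id.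
by rewrite root_rep hy.
Qed.

End Rep.

Section Exact.
Variables (G : signed_graph) (flip rot : {perm dart G}).
Hypothesis flipP : is_flip flip.
Hypothesis rotP : is_rotation rot.
Local Notation face := (porbit (flip * rot)%g).
Local Notation adj := (@dart_adj G).

Lemma dart_of_ex (e : edge G) : exists x : dart G, dart_edge x == e.
Proof.
have : (0 < #|ends e|)%N by rewrite card_ends.
by case/card_gt0P => v hv; exists (exist _ (v, e) hv : dart G).
Qed.

Definition dart_of e := xchoose (dart_of_ex e).

Lemma dart_ofK e : dart_edge (dart_of e) = e.
Proof. exact/eqP/(xchooseP (dart_of_ex e)). Qed.

Lemma dart_eq (x y : dart G) :
  dart_vert x = dart_vert y -> dart_edge x = dart_edge y -> x = y.
Proof.
rewrite /dart_vert /dart_edge => h1 h2; apply: val_inj.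
by rewrite [val x]surjective_pairing [val y]surjective_pairing h1 h2.
Qed.

Lemma ends_flip x : ends (dart_edge x) = [set dart_vert x; dart_vert (flip x)].
Proof.
have [h1 h2] := flipP x.
have nv : dart_vert x != dart_vert (flip x).
  by apply: contra h1 => /eqP h; apply/eqP/dart_eq.
apply/esym/eqP; rewrite eqEcard card_ends cards2 nv andbT subUset !sub1set.
by rewrite (valP x) -{1}h2 (valP (flip x)).
Qed.

Lemma flip_uniq x y : dart_edge y = dart_edge x -> y != x -> y = flip x.
Proof.
move=> h1 h2; have [_ h3] := flipP x; apply: dart_eq; last by rewrite h3.
have := valP y; rewrite -/(dart_vert y) -/(dart_edge y) h1 ends_flip !inE.
by case/orP => /eqP // h; rewrite (dart_eq h h1) eqxx in h2.
Qed.

Lemma flipK x : flip (flip x) = x.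
Proof.
have [h1 h2] := flipP x; have [h3 h4] := flipP (flip x).
by apply/esym; apply: flip_uniq => //; rewrite eq_sym.
Qed.

Lemma sum_darts (K : nmodType) (F : dart G -> K) :
  \sum_x F x = \sum_e (F (dart_of e) + F (flip (dart_of e))).
Proof.
rewrite (partition_big (@dart_edge G) predT) //=; apply: eq_bigr => e _.
have [h1 h2] := flipP (dart_of e); rewrite dart_ofK in h2.
rewrite (bigD1 (dart_of e)) ?dart_ofK //=; congr (_ + _).
rewrite (big_pred1 (flip (dart_of e))) // => x /=.
apply/andP/eqP => [[/eqP h3 h4]|->]; last by rewrite h2.
by apply: flip_uniq; rewrite ?dart_ofK.
Qed.

(** [rot x] follows [flip x] in its face: turning at a vertex and crossing an edge lead to the same
    face. *)
Lemma face_rot x : face (rot x) = face (flip x).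
Proof. by rewrite -(porbit_next _ (flip x)) permM flipK. Qed.

Lemma adjC : connect_sym adj.
Proof.
apply: sym_connect_sym => x y; rewrite /dart_adj /=.
by rewrite [dart_vert x == _]eq_sym [dart_edge x == _]eq_sym.
Qed.

Lemma adj_flip x : connect adj x (flip x).
Proof. by apply: connect1; rewrite /dart_adj /= (flipP x).2 eqxx orbT. Qed.

Lemma adj_rot x : connect adj x (rot x).
Proof.
apply: connect1; rewrite /dart_adj /= eq_sym -(rotP x (rot x)).
by rewrite -eq_porbit_mem porbit_next eqxx.
Qed.

Lemma adj_face x : connect adj x ((flip * rot)%g x).
Proof. by rewrite permM; apply: connect_trans (adj_flip x) (adj_rot _). Qed.

Lemma card_porbits_flip : #|porbits flip| = #|edge G|.
Proof.
have edge_porbit x y : y \in porbit flip x -> dart_edge y = dart_edge x.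
  case/porbitP => i ->; elim: i => [|i IH]; first by rewrite perm1.
  by rewrite expgSr permM (flipP _).2.
rewrite -cardsT -(@card_in_imset _ _ (fun e => porbit flip (dart_of e))); last
  first.
  move=> e e' _ _ h; rewrite -(dart_ofK e) -(dart_ofK e'); apply: edge_porbit.
  by rewrite -h porbit_id.
apply: eq_card => B; apply/imsetP/imsetP => [[x _ ->]|[e _ ->]]; last by exists
  (dart_of e).
exists (dart_edge x) => //; case: (eqVneq (dart_of (dart_edge x)) x) => [-> //|h].
by rewrite (flip_uniq _ h) ?dart_ofK // porbit_next.
Qed.

Lemma dart_cases x : x = dart_of (dart_edge x) \/ x = flip (dart_of (dart_edge
  x)).
Proof.
case: (eqVneq x (dart_of (dart_edge x))) => h; first by left.
by right; apply: flip_uniq; rewrite ?dart_ofK.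
Qed.

(** * Face sums and coboundaries *)

Section Chains.
Variable K : finZmodType.

(** The sum along the boundary of a face, equivalently the boundary of h as a chain of the dual
    graph. An edge with F on both sides cancels. *)
Definition bd (h : edge G -> K) (F : {set dart G}) : K :=
  \sum_e (h e *+ (dart_of e \in F) - h e *+ (flip (dart_of e) \in F)).

Definition cobd (u : dart G -> K) : {ffun edge G -> K} :=
  [ffun e => u (rep rot (flip (dart_of e))) - u (rep rot (dart_of e))].

(** The sum telescopes: the dart after y in its face is [rot (flip y)], which starts where y
    ends. *)
Lemma bd_cobd u x : bd (cobd u) (face x) = 0.
Proof.
pose w y := u (rep rot (flip y)) - u (rep rot y).
have -> : bd (cobd u) (face x) = \sum_y w y *+ (y \in face x).
  rewrite sum_darts; apply: eq_bigr => e _; rewrite ffunE -/(w (dart_of e)).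
  by rewrite -mulNrn /w flipK opprB.
under eq_bigr do rewrite mulrnBl; rewrite sumrB; apply/eqP; rewrite subr_eq0;
  apply/eqP.
rewrite [RHS](reindex_inj (@perm_inj _ (flip * rot)%g)); apply: eq_bigr => y _ /=.
rewrite !permM (@eq_rep _ _ (rot (flip y)) (flip y)) ?porbit_next //.
by rewrite -!eq_porbit_mem -permM porbit_next.
Qed.

Lemma bdD h h' F : bd (fun e => h e + h' e) F = bd h F + bd h' F.
Proof.
rewrite /bd -big_split; apply: eq_bigr => e _ /=; rewrite !mulrnDl opprD.
by rewrite addrACA.
Qed.

Lemma bd_edge x (c : K) : exists h : {ffun edge G -> K}, forall F,
  bd h F = c *+ (x \in F) - c *+ (flip x \in F).
Proof.
have [->|h0] := eqVneq x (dart_of (dart_edge x)).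
  set e0 := dart_edge x; exists [ffun e => if e == e0 then c else 0] => F.
  rewrite /bd (bigD1 e0) //= big1 ?addr0 ?ffunE ?eqxx // => e /negPf he.
  by rewrite ffunE he !mul0rn subrr.
set e0 := dart_edge x; exists [ffun e => if e == e0 then - c else 0] => F.
have -> : x = flip (dart_of e0) by apply: flip_uniq; rewrite ?dart_ofK.
rewrite flipK /bd (bigD1 e0) //= big1 ?addr0 ?ffunE ?eqxx.
  by rewrite !mulNrn opprK addrC.
by move=> e /negPf he; rewrite ffunE he !mul0rn subrr.
Qed.

(** The amount c is carried from face to face across edges: [flip] crosses one, and [rot x] lies in
    the face of [flip x]. *)
Lemma bd_connect x y (c : K) : connect adj x y ->
  exists h : {ffun edge G -> K}, forall z,
    bd h (face z) = c *+ (x \in face z) - c *+ (y \in face z).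
Proof.
have tr x' y' z' : (exists h : {ffun edge G -> K}, forall z,
    bd h (face z) = c *+ (x' \in face z) - c *+ (y' \in face z)) ->
    (exists h : {ffun edge G -> K}, forall z,
    bd h (face z) = c *+ (y' \in face z) - c *+ (z' \in face z)) ->
    exists h : {ffun edge G -> K}, forall z,
    bd h (face z) = c *+ (x' \in face z) - c *+ (z' \in face z).
  case=> h1 e1 [h2 e2]; exists [ffun e => h1 e + h2 e] => z.
  rewrite -[RHS](subrKA (c *+ (y' \in face z))) -e1 -e2 -bdD.
  by apply: eq_bigr => e _; rewrite ffunE.
have refl x' : exists h : {ffun edge G -> K}, forall z,
    bd h (face z) = c *+ (x' \in face z) - c *+ (x' \in face z).
  exists [ffun=> 0] => z; rewrite subrr /bd big1 // => e _.
  by rewrite ffunE !mul0rn subrr.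
have flp x' : exists h : {ffun edge G -> K}, forall z,
    bd h (face z) = c *+ (x' \in face z) - c *+ (flip x' \in face z).
  by have [h eh] := bd_edge x' c; exists h.
have rt x' : exists h : {ffun edge G -> K}, forall z,
    bd h (face z) = c *+ (x' \in face z) - c *+ (rot x' \in face z).
  have [h eh] := flp x'; exists h => z; rewrite eh.
  by rewrite -!eq_porbit_mem face_rot.
case/connectP => p; elim: p x => [|x1 p IH] x /=; first by move=> _ ->; apply:
  (refl).
case/andP => xx1 /IH{}IH /IH{}IH; apply: (tr _ _ _ _ IH).
case/orP: xx1 => /eqP e.
  have : x1 \in porbit rot x by rewrite rotP e.
  case/porbitP => i ->; elim: i => [|i IHi]; first by rewrite perm1; apply: refl.
  by rewrite expgSr permM; apply: (tr _ _ _ IHi (rt _)).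
have [->|h] := eqVneq x1 x; first exact: refl.
by rewrite (flip_uniq (esym e) h); apply: flp.
Qed.

Hypothesis euler : (#|porbits rot| + #|porbits (flip * rot)%g| =
  #|porbits flip| + 2 * n_comp adj predT)%N.

(* By Euler's formula the number of edges is |NV| + |NF|.  The coboundaries
   give |K|^|NV| elements of Ker, and the face sums of the chains take at least
   |K|^|NF| values, so that Ker contains nothing else. *)
Lemma exact (h : {ffun edge G -> K}) : (forall x, bd h (face x) = 0) ->
  exists u, h = cobd u.
Proof.
pose Ker := [set h : {ffun edge G -> K} | [forall x, bd h (face x) == 0]].
pose NV := nonroots rot adj; pose NF := nonroots (flip * rot)%g adj.
have eqE : #|edge G| = (#|NV| + #|NF|)%N.
  move: euler; rewrite card_porbits_flip.
  rewrite (card_nonroots adjC adj_rot) (card_nonroots adjC adj_face) -/NV -/NF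
    mul2n -addnn addnACA.
  by move/addIn.
(* Functions vanishing outside N: normalized potentials for [NV], prescribed face sums for [NF]. *)
pose U (N : {set dart G}) := pffun_on (0 : K) N predT.
have cardU N : #|U N| = (#|K| ^ #|N|)%N by rewrite card_pffun_on.
have out N (u : {ffun dart G -> K}) x : u \in U N -> x \notin N -> u x = 0.
  case/pffun_onP => /subsetP hs _ xN; apply/eqP/negPn/negP => nz.
  by have := hs x; rewrite inE nz (negPf xN) => /(_ isT).
have KV (u : {ffun dart G -> K}) : cobd u \in Ker.
  by rewrite inE; apply/forallP => x; rewrite bd_cobd.
(* Two potentials with the same coboundary differ by a constant on each component, and this constant
   is 0 at the orbit left out. *)
have injV : {in U NV &, injective (fun u : {ffun dart G -> K} => cobd u)}.
  move=> u u' hu hu' /ffunP huu.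
  pose w x := u (rep rot x) - u' (rep rot x).
  have w_flip x : w (flip x) = w x.
    have ho e : w (flip (dart_of e)) = w (dart_of e).
      by apply: sub_swap; have := huu e; rewrite !ffunE.
    case: (dart_cases x) => ->; first exact: ho.
    by rewrite flipK ho.
  have w_adj x y : connect adj x y -> w x = w y.
    case/connectP => p; elim: p x => [|x1 p IH] x /=; first by move=> _ ->.
    case/andP => xx1 /IH{}IH /IH <-; case/orP: xx1 => /eqP e.
      by rewrite /w (@eq_rep _ _ x x1) //; apply/eqP; rewrite eq_porbit_mem
        porbit_sym rotP e.
    by have [->//|ne] := eqVneq x1 x; rewrite (flip_uniq (esym e) ne) w_flip.
  apply/ffunP => x; case: (boolP (x \in NV)) => xN; last by rewrite !(out _ _ _
    _ xN).
  have := w_adj x (fingraph.root adj x) (connect_root adj x).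
  have rN : rep rot (fingraph.root adj x) \notin NV.
    by rewrite inE rep_id eqxx /= (root_rep adjC adj_rot) root_root ?eqxx //;
      exact: adjC.
  move: xN; rewrite inE => /andP [/eqP xE _].
  rewrite /w !(out _ _ _ _ rN) // xE subrr => /eqP.
  by rewrite subr_eq0 => /eqP.
pose r y := rep (flip * rot)%g (fingraph.root adj y).
have rE y : connect adj y (r y).
  by rewrite -(root_connect adjC) /r (root_rep adjC adj_face) root_root //;
    exact: adjC.
(* A chain moving c from the face of y to the face left out in its component. *)
have hsel y c : exists h : {ffun edge G -> K}, [forall z,
    bd h (face z) == c *+ (y \in face z) - c *+ (r y \in face z)].
  by have [h0 eh] := bd_connect c (rE y); exists h0; apply/forallP => z;
    rewrite eh.
pose hs y c := xchoose (hsel y c).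
have bd_hs y c z : bd (hs y c) (face z) = c *+ (y \in face z) - c *+ (r y \in
  face z).
  by apply/eqP; exact: (forallP (xchooseP (hsel y c))).
pose sec (u : {ffun dart G -> K}) := [ffun e => \sum_(y in NF) hs y (u y) e].
have bd_sec u z : z \in NF -> bd (sec u) (face z) = u z.
  move=> zN; have -> : bd (sec u) (face z) = \sum_(y in NF) bd (hs y (u y))
    (face z).
    rewrite [RHS]exchange_big; apply: eq_bigr => e _.
    by rewrite ffunE -!sumrMnl -sumrB.
  move: (zN); rewrite inE => /andP [/eqP zE zr].
  have mem_z y : rep (flip * rot)%g y = y -> (y \in face z) = (y == z).
    move=> yE; apply/idP/eqP => [|->]; last exact: porbit_id.
    by rewrite -eq_porbit_mem => /eqP /eq_rep; rewrite yE zE.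
  rewrite (bigD1 z) //= big1 ?addr0.
    rewrite bd_hs porbit_id mem_z ?rep_id // [r z == z]eq_sym (negPf zr).
    by rewrite mulr0n subr0.
  move=> y /andP [yN yz]; move: yN; rewrite inE => /andP [/eqP yE _].
  rewrite bd_hs mem_z // (negPf yz) mem_z ?rep_id //.
  case: eqP => [rz|_]; last by rewrite subrr.
  have rzE : fingraph.root adj z = fingraph.root adj y.
    by rewrite -rz /r (root_rep adjC adj_face) (root_root adjC).
  by rewrite rzE -/(r y) rz eqxx in zr.
pose f (hu : {ffun edge G -> K} * {ffun dart G -> K}) := [ffun e => hu.1 e +
  sec hu.2 e].
have bd_f h0 u z : h0 \in Ker -> z \in NF -> bd (f (h0, u)) (face z) = u z.
  rewrite inE => /forallP /(_ z) /eqP hz zN; rewrite -(bd_sec u z zN).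
  rewrite -[RHS]add0r -hz -bdD; apply: eq_bigr => e _.
  by rewrite ffunE.
have injF : {in setX Ker [set u in U NF] &, injective f}.
  move=> [h1 u1] [h2 u2] /setXP [/= k1 v1] /setXP [/= k2 v2] e12.
  have {}v1 : u1 \in U NF by rewrite inE in v1.
  have {}v2 : u2 \in U NF by rewrite inE in v2.
  have eu : u1 = u2.
    apply/ffunP => z; case: (boolP (z \in NF)) => zN; last by rewrite (out _ _
      _ v1 zN) (out _ _ _ v2 zN).
    have q1 : bd (f (h1, u1)) (face z) = u1 z by apply: bd_f.
    have q2 : bd (f (h2, u2)) (face z) = u2 z by apply: bd_f.
    by rewrite -q1 e12 q2.
  congr (_, _) => //; apply/ffunP => e; have := congr1 (fun g : {ffun _ -> _}
    => g e) e12.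
  by rewrite !ffunE /= eu => /addIr.
have Kgt0 : (0 < #|K|)%N by apply/card_gt0P; exists 0.
have leK : (#|Ker| <= #|K| ^ #|NV|)%N.
  rewrite -(@leq_pmul2r (#|K| ^ #|NF|)) ?expn_gt0 ?Kgt0 // -expnD -eqE -card_ffun.
  rewrite -cardU -[#|U NF|]cardsE -cardsX -(card_in_imset injF).
  exact: max_card.
have imV : (fun u : {ffun dart G -> K} => cobd u) @: U NV = Ker.
  apply/eqP; rewrite eqEcard (card_in_imset injV) cardU leK andbT.
  by apply/subsetP => _ /imsetP [u _ ->].
move=> hK; have : h \in Ker by rewrite inE; apply/forallP => x; rewrite hK.
by rewrite -imV => /imsetP [u _ ->]; exists u.
Qed.

Lemma potential (h : edge G -> K) : (forall x, bd h (face x) = 0) ->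
  exists p : vert G -> K, forall e,
    p (dart_vert (flip (dart_of e))) - p (dart_vert (dart_of e)) = h e.
Proof.
move=> hK; have [|u hu] := @exact [ffun e => h e].
  by move=> x; rewrite -(hK x); apply: eq_bigr => e _; rewrite ffunE.
(* Isolated vertices carry no dart and get 0. *)
pose p v := if [pick x | @dart_vert G x == v] is Some x then u (rep rot x) else 0.
have pE x : p (dart_vert x) = u (rep rot x).
  rewrite /p; case: pickP => [y /eqP e|/(_ x)]; last by rewrite eqxx.
  by rewrite (@eq_rep _ _ y x) //; apply/eqP; rewrite eq_porbit_mem porbit_sym
    rotP e.
by exists p => e; have /ffunP /(_ e) := hu; rewrite !ffunE !pE.
Qed.

End Chains.
End Exact.

(** * Negative cycles in even subgraphs *)

Lemma big_next (T : eqType) (c : seq T) (R : nmodType) (f : T -> R) : uniq c ->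
  \sum_(d <- c) f (path.next c d) = \sum_(d <- c) f d.
Proof.
move=> uc; rewrite -(big_map (path.next c) xpredT f); apply: perm_big.
apply: uniq_perm => //.
  by rewrite map_inj_uniq //; apply: (can_inj (prev_next uc)).
move=> x; apply/mapP/idP => [[y yc ->]|xc]; first by rewrite mem_next.
by exists (prev c x); rewrite ?mem_prev // next_prev.
Qed.

Section Cycles.
Variable G : signed_graph.
Local Notation walk := (seq (vert G * edge G)).

Lemma cycle_next (c : walk) d : is_cycle c -> d \in c ->
  ends d.2 = [set d.1; (path.next c d).1].
Proof. by case/and4P => _ hc _ _ dc; have /eqP := next_cycle hc dc. Qed.

Lemma cycle_uniq (c : walk) : is_cycle c -> uniq c.
Proof. by case/and4P => _ _ uc _; apply: map_uniq uc. Qed.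

Lemma sum_cycle_edges (c : walk) (f : edge G -> nat) : is_cycle c ->
  (\sum_(d <- c) f d.2 = \sum_(e in [set e in unzip2 c]) f e)%N.
Proof.
case/and4P => _ _ _ ue; rewrite -(big_map (@snd _ _) xpredT f) big_uniq //.
by apply: eq_bigl => e; rewrite inE.
Qed.

Lemma end2 (e : edge G) (x y : vert G) : ends e = [set x; y] -> x != y.
Proof. by move=> h; have := card_ends e; rewrite h cards2; case: (x != y). Qed.

(** Each edge joins the vertex of its pair to that of the next pair, and [path.next] permutes c, so
    both kinds of ends meet v equally often. *)
Lemma cycle_even (c : walk) v : is_cycle c ->
  ~~ odd (\sum_(e in [set e in unzip2 c]) (v \in ends e)).
Proof.
move=> hc; rewrite -sum_cycle_edges //.
have -> : (\sum_(d <- c) (v \in ends d.2) =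
    \sum_(d <- c) (v == d.1) + \sum_(d <- c) (v == (path.next c d).1))%N.
  rewrite -big_split /=; apply: eq_big_seq => d dc.
  have h := cycle_next hc dc; have := end2 h; rewrite h !inE.
  by case: (eqVneq v d.1) => [->|] //=; case: eqP.
have -> : (\sum_(d <- c) (v == (path.next c d).1) = \sum_(d <- c) (v == d.1))%N.
  exact: (big_next (fun d => (v == d.1) : nat) (cycle_uniq hc)).
by rewrite addnn odd_double.
Qed.


Section Walk.
Variable F : {set edge G}.
Hypothesis evenF : forall v, ~~ odd (\sum_(e in F) (v \in ends e)).

Definition along (d : vert G * edge G) := (d.2 \in F) && (d.1 \in ends d.2).

(** At the far end of the edge, even degree provides another edge, so the walk never has to turn
    back. *)
Lemma step_ex d : along d -> exists d',
  [&& along d', walk_step d d' & d'.2 != d.2].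
Proof.
case: d => v e /andP /= [eF ve].
have [w hw] : exists w, ends e = [set v; w].
  have /cards1P [w hw] : #|ends e :\ v| == 1%N.
    by have := card_ends e; rewrite (cardsD1 v) ve add1n => /eqP.
  by exists w; rewrite -hw setD1K.
have we : w \in ends e by rewrite hw !inE eqxx orbT.
have [e' /and3P [e'F we' ne]|none] :=
    pickP (fun e' => [&& e' \in F, w \in ends e' & e' != e]).
  by exists (w, e'); rewrite /along /walk_step /= e'F we' ne hw eqxx.
have := evenF w; rewrite (bigD1 e) //= we big1 // => e' /andP [e'F ne].
by have := none e'; rewrite e'F ne andbT /= => ->.
Qed.

Definition step d := odflt d [pick d' | [&& along d', walk_step d d' & d'.2 !=
  d.2]].

Lemma stepP d : along d -> [&& along (step d), walk_step d (step d) & (step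
  d).2 != d.2].
Proof.
move=> hd; rewrite /step; case: pickP => [d' //|none].
by have [d' h] := step_ex hd; rewrite none in h.
Qed.

Lemma along_iter d i : along d -> along (iter i step d).
Proof. by move=> hd; elim: i => //= i /stepP /and3P []. Qed.

Lemma closed_traject d k : along d -> (0 < k)%N ->
  uniq (unzip1 (traject step d k)) -> (iter k step d).1 = d.1 ->
  is_cycle (traject step d k).
Proof.
move=> hd; case: k => // k _ uv closed.
have vE i : (i <= k)%N -> nth d.1 (unzip1 (traject step d k.+1)) i = (iter i
  step d).1.
  by move=> ik; rewrite (nth_map d) ?size_traject ?ltnS // nth_traject.
have walkE i : ends (iter i step d).2 = [set (iter i step d).1; (iter i.+1 step
  d).1].
  by have /and3P [_ /eqP ->] := stepP (along_iter i hd).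
have vinj i j : (i <= k)%N -> (j <= k)%N ->
    (iter i step d).1 = (iter j step d).1 -> i = j.
  move=> ik jk h; have /(uniqP d.1) := uv; apply.
  - by rewrite inE size_map size_traject ltnS.
  - by rewrite inE size_map size_traject ltnS.
  - by rewrite !vE.
apply/and4P; split=> //.
  rewrite /= rcons_path; apply/andP; split.
    have : forall n x, along x -> path.path (@walk_step G) x (traject step
      (step x) n).
      elim=> //= n IH x hx; have /and3P [h1 -> _] := stepP hx; exact: IH.
    exact.
  rewrite last_traject /walk_step /= -closed; exact/eqP/walkE.
apply/(uniqP d.2) => a b; rewrite !inE size_map size_traject.
(* Equal edges at i < j place vertex j among vertices i and i + 1, so j = i + 1; but consecutive
   edges differ. *)
have neq i j : (i < j <= k)%N -> (iter i step d).2 != (iter j step d).2.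
  case/andP => ij jk; apply/eqP => h.
  have := walkE i; rewrite h walkE => hh.
  have : (iter j step d).1 \in [set (iter i step d).1; (iter i.+1 step d).1].
    by rewrite -hh !inE eqxx.
  rewrite !inE => /orP [] /eqP /vinj; last first.
    move=> /(_ jk (leq_trans ij jk)) e.
    by have /and3P [_ _] := stepP (along_iter i hd); rewrite -[step _]/(iter
      i.+1 step d) -e h eqxx.
  by move=> /(_ jk (leq_trans (ltnW ij) jk)) e; rewrite e ltnn in ij.
rewrite !ltnS => ak bk; rewrite !(nth_map d) ?size_traject ?ltnS //
  !nth_traject ?ltnS //.
move=> h; case: (ltngtP a b) => // ab.
  by have := neq a b; rewrite ab bk h eqxx => /(_ isT).
by have := neq b a; rewrite ab ak h eqxx => /(_ isT).
Qed.

Lemma cycle_ex d : along d -> exists2 c, is_cycle c & {subset unzip2 c <= F}.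
Proof.
move=> hd.
have : exists n, ~~ uniq (unzip1 (traject step d n)).
  exists #|vert G|.+1; apply/negP => /card_uniqP h.
  by have := max_card (mem (unzip1 (traject step d #|vert G|.+1))); rewrite h
    size_map size_traject ltnn.
move/ex_minnP => [[|n] //] nu min_n.
have un : uniq (unzip1 (traject step d n)).
  by apply/negPn/negP => /min_n; rewrite ltnn.
move: nu; rewrite trajectSr /unzip1 map_rcons rcons_uniq un andbT negbK.
move=> /(nthP d.1) [i]; rewrite size_map size_traject => iltn.
rewrite (nth_map d) ?size_traject // nth_traject // => hi.
(* The walk is cut at its first repeated vertex, reached at times i and n. *)
exists (traject step (iter i step d) (n - i)); last first.
  move=> e /mapP [d' /trajectP [j _ ->] ->]; rewrite -iterD.
  by have /andP [] := along_iter (j + i) hd.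
apply: closed_traject; first exact: along_iter.
- by rewrite subn_gt0.
- move: un; rewrite -{1}(subnKC (ltnW iltn)) trajectD /unzip1 map_cat cat_uniq.
  by case/and3P.
- by rewrite -iterD subnK // ltnW.
Qed.

End Walk.

(** An even subgraph decomposes into edge-disjoint cycles, one of which has an odd number of
    negative edges. *)
Lemma negative_cycle_ex (F : {set edge G}) :
  (forall v, ~~ odd (\sum_(e in F) (v \in ends e))) ->
  odd (\sum_(e in F) negative e) ->
  exists2 c : walk, negative_cycle c & (size c <= #|F|)%N.
Proof.
have [n] := ubnP #|F|; elim: n F => // n IHn F; rewrite ltnS => hn evenF oddF.
have [e eF] : exists e, e \in F.
  by apply/set0Pn; apply: contraTneq oddF => ->; rewrite big_set0.
have [v ve] : exists v, v \in ends e by apply/card_gt0P; rewrite card_ends.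
have [c hc cF] := @cycle_ex F evenF (v, e) (introT andP (conj eF ve)).
pose E := [set e in unzip2 c].
have EF : E \subset F by apply/subsetP => e'; rewrite inE => /cF.
have splitF (f : edge G -> nat) :
    (\sum_(e in F) f e = \sum_(e in E) f e + \sum_(e in F :\: E) f e)%N.
  by rewrite (big_setID E) /= (setIidPr EF).
have sizeE : size c = #|E|.
  have /and4P [_ _ _ ue] := hc.
  by rewrite cardsE (card_uniqP ue) size_map.
have c0 : (0 < #|E|)%N by rewrite -sizeE; case/and4P: hc; case: (c).
case: (boolP (odd (\sum_(e in E) negative e))) => oE.
  exists c; last by rewrite sizeE subset_leq_card.
  rewrite /negative_cycle hc /sign.
  rewrite prodrXr (sum_cycle_edges (fun e' => negative e' : nat)) //.
  by rewrite -signr_odd oE expr1 eqxx.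
have [| | |c' h1 h2] := IHn (F :\: E).
- apply: leq_trans hn; apply: proper_card; rewrite properE subsetDl /=.
  have /card_gt0P [e' e'E] := c0.
  by apply/negP => /subsetP /(_ e' (subsetP EF _ e'E)); rewrite inE e'E.
- move=> w; have := evenF w; rewrite splitF oddD.
  by rewrite (negPf (cycle_even w hc)).
- by move: oddF; rewrite splitF oddD (negPf oE).
exists c' => //; apply: leq_trans h2 _; exact: subset_leq_card (subsetDl _ _).
Qed.

End Cycles.

(** * The dual orientation and the coloring *)

Lemma Zp_int_eq0 (n : nat) (z : int) : (1 < n)%N ->
  (z%:~R == 0 :> 'Z_n) = (n%:Z %| z)%Z.
Proof.
move=> n1; have n0 : (n%:Z : int) != 0 by lia.
have nR : (n%:Z)%:~R = 0 :> 'Z_n by rewrite -pmulrn pchar_Zp.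
have [r er] : exists r : nat, (z %% n%:Z)%Z = r%:Z.
  by exists `|(z %% n%:Z)%Z|%N; rewrite gez0_abs // modz_ge0.
have rn : (r < n)%N by have := ltz_pmod z (d := n%:Z); rewrite er; lia.
rewrite {1}(divz_eq z n) er rmorphD rmorphM /= nR mulr0 add0r -pmulrn.
rewrite (sameP dvdz_mod0P eqP) er; apply/eqP/eqP => [h|[->]] //.
by have := val_Zp_nat n1 r; rewrite h modn_small // => <-.
Qed.

Lemma dvdz2_nat (n : nat) : (2 %| n%:Z)%Z = ~~ odd n.
Proof. by rewrite dvdzE dvdn2. Qed.

Section Dual.
Variables (G : signed_graph) (flip rot : {perm dart G}).
Hypothesis flipP : is_flip flip.
Hypothesis rotP : is_rotation rot.
Local Notation face := (porbit (flip * rot)%g).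
Local Notation dart_of := (@dart_of G).

Definition fs e := face (dart_of e).
Definition ft e := face (flip (dart_of e)).

Definition cutset (A : {set {set dart G}}) := [set e | (fs e \in A) != (ft e
  \in A)].

Lemma cut_cutset A : cut fs ft A = #|cutset A|%:Z.
Proof.
rewrite -sum1_card big_mkcond /= (big_morph Posz PoszD (erefl (0%N : int))).
by apply: eq_bigr => e _; rewrite inE; case: ifP.
Qed.

Lemma odd_sum (T : finType) (P : pred T) (f : T -> nat) :
  odd (\sum_(x | P x) f x)%N = \big[addb/false]_(x | P x) odd (f x).
Proof. exact: (big_morph odd oddD). Qed.

(** In one turn of [rot] around v, the face passes in and out of A an even number of times. *)
Lemma cutset_even A v : ~~ odd (\sum_(e in cutset A) (v \in ends e)).
Proof.
pose w (x : dart G) : nat :=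
  (dart_vert x == v) && ((face x \in A) != (face (flip x) \in A)).
have -> : (\sum_(e in cutset A) (v \in ends e) = \sum_x w x)%N.
  rewrite [RHS](sum_darts flipP) big_mkcond; apply: eq_bigr => e _.
  have := ends_flip flipP (dart_of e); rewrite dart_ofK => he.
  have := end2 he; rewrite he !inE /w (flipK flipP) -/(fs e) -/(ft e).
  rewrite [v == _]eq_sym [v == dart_vert (flip _)]eq_sym [(ft e \in A) ==
    _]eq_sym.
  case: (eqVneq (dart_vert (dart_of e)) v) => [->|_];
    case: (eqVneq (dart_vert (flip (dart_of e))) v) => [_|_] //=;
    by case: (_ \in A); case: (_ \in A).
pose chi (x : dart G) : nat := face x \in A.
have -> : odd (\sum_x w x) = odd (\sum_(x | dart_vert x == v) (chi x + chi (rot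
  x))).
  rewrite !odd_sum [RHS]big_mkcond; apply: eq_bigr => x _.
  rewrite /w /chi (face_rot rot flipP); case: eqP => //= _.
  by case: (_ \in A); case: (_ \in A).
have rot_vert x : dart_vert (rot x) = dart_vert x.
  by apply/eqP; rewrite -(rotP x (rot x)) -eq_porbit_mem porbit_next.
rewrite big_split /= [X in (_ + X)%N](_ : _ = \sum_(x | dart_vert x == v) chi
  x)%N.
  by rewrite addnn odd_double.
rewrite [RHS](reindex_inj (@perm_inj _ rot)) /=.
by apply: eq_bigl => x; rewrite rot_vert.
Qed.


(** Every edge has exactly one end in B, so the size is the sum of the even degrees over B. *)
Lemma cutset_card_even A : bipartite G -> ~~ odd #|cutset A|.
Proof.
case=> B hB; have -> : (#|cutset A| = \sum_(v in B) \sum_(e in cutset A) (v \in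
  ends e))%N.
  rewrite exchange_big -sum1_card; apply: eq_bigr => e _ /=.
  rewrite -(hB e) -sum1_card big_mkcond [RHS]big_mkcond /=; apply: eq_bigr => v _.
  by rewrite !inE; case: (v \in B); rewrite ?andbT ?andbF //; case: (_ \in ends
    _).
by rewrite odd_sum big1 // => v _; apply/negbTE/cutset_even.
Qed.

Variable k : nat.
Hypothesis k_gt0 : (0 < k)%N.
Hypothesis bip : bipartite G.
Hypothesis girth : negative_girth_ge G (6 * k - 2).
Local Notation S := (porbits (flip * rot)%g).
Local Notation m := (2 * k)%N.
Local Notation M := ((2 * (2 * k))%:Z).

(** A negative edge with F on both sides counts twice, that is, 0 modulo 2m. *)
Definition fq (F : {set dart G}) : int :=
  m%:Z * \sum_e (negative e)%:Z * ((fs e == F)%:Z + (ft e == F)%:Z).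

Lemma fs_S e : (fs e \in S) && (ft e \in S).
Proof. by rewrite /fs /ft /porbits !imset_f. Qed.

Lemma sum_fq (A : {set {set dart G}}) : \sum_(F in A) fq F =
  m%:Z * \sum_e (negative e)%:Z * ((fs e \in A)%:Z + (ft e \in A)%:Z).
Proof.
rewrite -mulr_sumr exchange_big; congr (_ * _); apply: eq_bigr => e _.
by rewrite -mulr_sumr big_split /= !sum_indic.
Qed.

Lemma fq_even (A : {set {set dart G}}) : ~~ odd (\sum_(e in cutset A) negative
  e) ->
  (M %| \sum_(F in A) fq F)%Z.
Proof.
move=> h; rewrite sum_fq.
have [j ->] : exists j : int,
    \sum_e (negative e)%:Z * ((fs e \in A)%:Z + (ft e \in A)%:Z) = j * 2.
  apply/dvd2P.
  have : (2 %| (\sum_(e in cutset A) negative e)%N%:Z)%Z by rewrite dvdz2_nat.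
  rewrite (big_morph Posz PoszD (erefl (0%N : int))) big_mkcond => h2.
  rewrite -[X in (_ %| X)%Z](subrK (\sum_e (if e \in cutset A then (negative
    e)%:Z else 0))).
  apply: rpredD h2; apply: sum_dvd => e _; rewrite inE.
  by case: (negative e); case: (fs e \in A); case: (ft e \in A).
by apply/dvdzP; exists j; rewrite !PoszM; ring.
Qed.

Lemma dual_orientation : solvable m fs ft S fq.
Proof.
have cut_even A : (2 %| cut fs ft A)%Z.
  by rewrite cut_cutset dvdz2_nat cutset_card_even.
have mq (F : {set dart G}) : (m%:Z %| fq F)%Z by rewrite dvdz_mulr.
apply: odd_solvable => //.
- by lia.
- split; first exact: fs_S.
    rewrite sum_fq (eq_bigr (fun e => (negative e)%:Z * 2)).
      rewrite -mulr_suml; set N := \sum_e _.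
      by apply/dvdzP; exists N; rewrite !PoszM; ring.
    by move=> e _; have /andP [-> ->] := fs_S e.
  move=> A _; rewrite rpredB //; apply: rpred_sum => F _.
  by apply: dvdz_trans (mq F); rewrite PoszM dvdz_mulr.
move=> A _ oA; rewrite cut_cutset.
have oddA : odd (\sum_(e in cutset A) negative e).
  by apply: contraR oA => /fq_even.
have [c hc szc] := negative_cycle_ex (cutset_even A) oddA.
have := girth hc; lia.
Qed.

Hypothesis euler : (#|porbits rot| + #|porbits (flip * rot)%g| =
  #|porbits flip| + 2 * n_comp (@dart_adj G) predT)%N.

Lemma integer_potential : exists p : vert G -> int,
  (forall v, 0 <= p v < (4 * k)%:Z) /\ forall e, exists d : bool,
    (M %| p (dart_vert (flip (dart_of e))) - p (dart_vert (dart_of e))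
      - (sg d + m%:Z * (~~ negative e)%:Z))%Z.
Proof.
have [o ho] := dual_orientation.
pose n := (2 * (2 * k))%N.
have n1 : (1 < n)%N by rewrite /n; lia.
pose hz e : int := sg (o e) + m%:Z * (~~ negative e)%:Z.
have [|p hp] := @potential G flip rot flipP rotP 'Z_n euler (fun e => (hz e)%:~R).
  move=> x; pose F := face x.
  have -> : bd flip (fun e => (hz e)%:~R) F =
      (net fs ft o F + m%:Z * \sum_e (~~ negative e)%:Z * ((fs e == F)%:Z - (ft
        e == F)%:Z))%:~R
      :> 'Z_n.
    rewrite mulr_sumr -big_split /= rmorph_sum /=; apply: eq_bigr => e _.
    rewrite -!eq_porbit_mem -/(fs e) -/(ft e) -/F.
    rewrite (_ : _ + _ = hz e * (fs e == F)%:Z - hz e * (ft e == F)%:Z); last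
      first.
      by rewrite /hz; ring.
    by rewrite rmorphB !rmorphM /= -!pmulrn !mulr_natr.
  suff h : (M %| net fs ft o F +
      m%:Z * \sum_e (~~ negative e)%:Z * ((fs e == F)%:Z - (ft e == F)%:Z))%Z.
    by apply/eqP; move: h; rewrite -(Zp_int_eq0 _ n1).
  have FS : F \in S by rewrite /F /porbits imset_f.
  rewrite -[X in (_ %| X + _)%Z](subrK (fq F)) -addrA rpredD ?ho // /fq -mulrDr
    -big_split /=.
  (* As m and -m agree modulo 2m, positive edges also count m per side. The total is m times the
     length of the face boundary, which has the parity of a cut and is therefore even. *)
  have /dvd2P [j hj] : (2 %| \sum_e ((negative e)%:Z * ((fs e == F)%:Z + (ft e
    == F)%:Z) +
      (~~ negative e)%:Z * ((fs e == F)%:Z - (ft e == F)%:Z)))%Z.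
    have cut_even : (2 %| cut fs ft [set F])%Z.
      by rewrite cut_cutset dvdz2_nat cutset_card_even.
    rewrite -[X in (_ %| X)%Z](subrK (cut fs ft [set F])); apply: rpredD cut_even.
    apply: sum_dvd => e _; rewrite !inE.
    by case: (negative e); case: (fs e == F); case: (ft e == F).
  by rewrite hj; apply/dvdzP; exists j; rewrite !PoszM; ring.
(* Representatives in [0, 4k) keep all differences strictly between -4k and 4k, as the tension
   requires after scaling. *)
exists (fun v => (val (p v))%:Z); split=> [v|e].
  have := ltn_ord (p v); rewrite [X in (_ < X)%N](Zp_cast n1) /n => h.
  by move: h; case: (p v) => [i _] /=; lia.
exists (o e); rewrite -(Zp_int_eq0 _ n1) -/(hz e) !rmorphB /= -!pmulrn !natr_Zp.
by rewrite hp subrr.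
Qed.

End Dual.

(** * From the potential to a circular tension *)

Lemma potential_cycle_sum (R : realType) (G : signed_graph)
    (D : edge G -> vert G * vert G) (pot : vert G -> R) c :
  is_orientation D -> is_cycle c ->
  cycle_sum D (fun e => pot (D e).2 - pot (D e).1) c = 0.
Proof.
move=> hD hc; rewrite /cycle_sum big_mkcond [X in _ - X]big_mkcond -sumrB /=.
rewrite (eq_big_seq (fun d => pot (path.next c d).1 - pot d.1)).
  by rewrite sumrB (big_next (fun d => pot d.1)) ?subrr // cycle_uniq.
move=> d dc; have hn := cycle_next hc dc; have hE := hD d.2.
have nd := end2 hn; have nD := end2 hE; rewrite hn in hE.
case: (eqVneq (D d.2).1 d.1) => [h1|h1] /=.
  rewrite subr0 h1; congr (pot _ - _).
  have : (path.next c d).1 \in [set (D d.2).1; (D d.2).2] by rewrite -hE !inE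
    eqxx orbT.
  by rewrite !inE h1 eq_sym (negPf nd) => /eqP.
have e1 : (D d.2).1 = (path.next c d).1.
  have : (D d.2).1 \in [set d.1; (path.next c d).1] by rewrite hE !inE eqxx.
  by rewrite !inE (negPf h1) => /eqP.
have e2 : (D d.2).2 = d.1.
  have : d.1 \in [set (D d.2).1; (D d.2).2] by rewrite -hE !inE eqxx.
  by rewrite !inE eq_sym (negPf h1) => /eqP.
by rewrite sub0r opprB e1 e2.
Qed.

(** These are the ranges of the tension multiplied by 2k - 1: r - 1 becomes 2k + 1, r/2 - 1 becomes
    1 and r/2 + 1 becomes 4k - 1. *)
Lemma edge_gap (k : nat) (x : int) (d neg : bool) : (0 < k)%N ->
  - (4 * k)%:Z < x < (4 * k)%:Z ->
  ((2 * (2 * k))%:Z %| x - (sg d + (2 * k)%:Z * (~~ neg)%:Z))%Z ->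
  if neg then (`|x| <= 1) || ((4 * k)%:Z - 1 <= `|x|)
  else (2 * k)%:Z - 1 <= `|x| <= (2 * k)%:Z + 1.
Proof.
move=> k0 /andP [h1 h2] hx.
have k1 : 1 <= k%:Z by lia.
have [j hj] : exists j : int, x - (sg d + (2 * k)%:Z * (~~ neg)%:Z) = j * (4 *
  k)%:Z.
  by move/dvdzP: hx => [j ->]; exists j; congr (_ * _); lia.
have K0 : 0 <= (4 * k)%:Z by [].
have j_lt2 : j < 2.
  rewrite ltNge; apply/negP => /(ler_wpM2r K0).
  by rewrite -hj; move: k1 h2; clear; rewrite /sg; case: d; case: neg => /=; lia.
have j_gt : - 2 < j.
  rewrite ltNge; apply/negP => /(ler_wpM2r K0).
  by rewrite -hj; move: k1 h1; clear; rewrite /sg; case: d; case: neg => /=; lia.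
have [jE|[jE|jE]] : j = -1 \/ j = 0 \/ j = 1 by move: j_lt2 j_gt; clear; lia.
all: move: hj h1 h2 k1; rewrite jE; clear; rewrite /sg; case: d; case: neg =>
  /=; lia.
Qed.

Theorem theorem6p4 (R : realType) (k : nat) (G : signed_graph) :
  (0 < k)%N ->
  bipartite G ->
  planar G ->
  negative_girth_ge G (6 * k - 2)%N ->
  circular_colorable G (4 * k%:R / (2 * k%:R - 1) : R).
Proof.
move=> k0 bip [flip [rot [flipP rotP euler]]] girth.
have [p [p_bound hp]] := integer_potential flipP rotP k0 bip girth euler.
pose D e := (dart_vert (dart_of e), dart_vert (flip (dart_of e))).
pose c : R := 2 * k%:R - 1.
have k1 : 1 <= k%:R :> R by rewrite (ler_nat _ 1).
have c0 : 0 < c by rewrite /c; lra.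
pose pot v := (p v)%:~R / c.
pose x e := p (D e).2 - p (D e).1.
have fE e : pot (D e).2 - pot (D e).1 = (x e)%:~R / c.
  by rewrite /pot -mulrBl -rmorphB.
have xb e : - (4 * k)%:Z < x e < (4 * k)%:Z.
  by have := p_bound (D e).1; have := p_bound (D e).2; rewrite /x; lia.
have gap e : if negative e then (`|x e| <= 1) || ((4 * k)%:Z - 1 <= `|x e|)
    else (2 * k)%:Z - 1 <= `|x e| <= (2 * k)%:Z + 1.
  by have [d hd] := hp e; exact: edge_gap k0 (xb e) hd.
have normE e : `|(x e)%:~R / c| = `|x e|%:~R / c.
  by rewrite normrM normfV (gtr0_norm c0) -intr_norm.
exists D, (fun e => pot (D e).2 - pot (D e).1); split.
- by move=> e; rewrite /D /= -(ends_flip flipP) dart_ofK.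
- move=> e; rewrite fE -ltr_norml normE ltr_pM2r ?invr_gt0 //.
  have : `|x e| < (4 * k)%:Z by have := xb e; lia.
  by rewrite -(ltr_int R) -pmulrn natrM.
- move=> e /negPf ne; rewrite fE normE; have := gap e; rewrite ne => /andP [h1
    h2].
  have {}h1 : c <= `|x e|%:~R by move: h1; rewrite -(ler_int R) rmorphB /=
    -pmulrn natrM.
  have {}h2 : `|x e|%:~R <= 2 * k%:R + 1 :> R.
    by move: h2; rewrite -(ler_int R) rmorphD /= -pmulrn natrM.
  rewrite ler_pdivlMr // mul1r h1 /= ler_pdivrMr //.
  by rewrite mulrBl mul1r -/c divfK ?gt_eqF // /c; move: h2; lra.
- move=> e ne; rewrite fE normE; have := gap e; rewrite ne.
  have rE : 4 * k%:R / (2 * k%:R - 1) / 2 = 2 * k%:R / c :> R.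
    by rewrite -/c; field; rewrite gt_eqF.
  rewrite rE; case/orP => h.
    have {}h : `|x e|%:~R <= 1 :> R by rewrite -(ler_int R) in h.
    apply/orP; left; rewrite divr_ge0 ?ler0z ?normr_ge0 ?(ltW c0) //=.
    by rewrite ler_pdivrMr // mulrBl mul1r divfK ?gt_eqF // /c; move: h; lra.
  have lt4 : `|x e|%:~R < 4 * k%:R :> R.
    have : `|x e| < (4 * k)%:Z by have := xb e; lia.
    by rewrite -(ltr_int R) -pmulrn natrM.
  have {}h : 4 * k%:R - 1 <= `|x e|%:~R :> R.
    by move: h; rewrite -(ler_int R) rmorphB /= -pmulrn natrM.
  apply/orP; right; rewrite ler_pdivlMr // mulrDl mul1r divfK ?gt_eqF //.
  rewrite ltr_pM2r ?invr_gt0 // lt4 andbT /c; move: h; lra.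
- by move=> w hw; apply: potential_cycle_sum hw => e; rewrite /D /= -(ends_flip
    flipP) dart_ofK.
Qed.
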